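(* Let $H$ be the half-line discrete Schrödinger operator on $\ell^2(\mathbb{N})$ with bounded real potential $V$. Assume that there exist $\beta>3$ and a strictly increasing sequence $\{q_\ell\}_{\ell=1}^\infty$ of integers $>1$ such that $\sup_{1\le j\le q_\ell}b_{q_\ell,j}<q_\ell^{-\beta}$ for all $\ell$. Then $\alpha_l^-\le 3/\beta$. If, moreover, the sequence $\{q_\ell\}_{\ell=1}^\infty$ is exponentially growing, then $\alpha_l^+\le 3/\beta$.
   Context: $\mathbb{N}=\{1,2,\dots\}$; $V=(V_n)_{n\in\mathbb{N}}$ is a bounded real sequence. The operator $H$ on $\ell^2(\mathbb{N})$ is $(H\psi)_n=\psi_{n+1}+\psi_{n-1}+V_n\psi_n$ for $n\ge2$ and $(H\psi)_1=\psi_2+V_1\psi_1$. For real $q\ge0$ and $T>0$, $$P(q,T)=\sum_{n>q}\frac2T\int_0^\infty\bigl|\langle\delta_n,e^{-itH}\delta_1\rangle\bigr|^2e^{-2t/T}\,dt .$$ The exponents are $$\alpha_l^+=\sup\Bigl\{\alpha>0:\limsup_{T\to\infty}\tfrac{\log P(T^\alpha,T)}{\log T}=0\Bigr\},\qquad \alpha_l^-=\sup\Bigl\{\alpha>0:\liminf_{T\to\infty}\tfrac{\log P(T^\alpha,T)}{\log T}=0\Bigr\}$$ (the supremum of the empty set is taken to be $0$). For an integer $q>1$ and $k\in[0,\pi]$, $H^q(k)$ is the $q\times q$ Hermitian matrix with diagonal entries $V_1,\dots,V_q$, entries $1$ in positions $(n,n\pm1)$, entry $e^{-ik}$ in position $(1,q)$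 and $e^{ik}$ in position $(q,1)$, and all other entries $0$ (for $q=2$ the entries falling in the same position are added). $E_{q,1}(k)\le\dots\le E_{q,q}(k)$ are its eigenvalues in increasing order with multiplicity, and $b_{q,j}=|E_{q,j}(\pi)-E_{q,j}(0)|$. A sequence $\{a_n\}$ of nonnegative numbers is exponentially growing if $\sup_n a_{n+1}/a_n<\infty$ and $\inf_n a_{n+1}/a_n>1$. *)

(* Defs.v *)
From HB Require Import structures.
From mathcomp Require Import all_boot all_order all_algebra.
From mathcomp Require Import complex.
From mathcomp Require Import all_classical all_reals all_analysis.

Set Implicit Arguments.
Unset Strict Implicit.
Unset Printing Implicit Defensive.

Import Order.TTheory GRing.Theory Num.Theory.
Import numFieldNormedType.Exports.

Local Open Scope classical_set_scope.
Local Open Scope ring_scope.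
Local Open Scope complex_scope.

(* Sites are shifted by one: a function on nat represents a sequence indexed
   by {1, 2, ...}, its value at n being the entry of index n.+1.  This applies
   to the potential V, to vectors of l^2 and to the basis delta. *)

Section Dynamics.
Variable R : realType.
Implicit Types (V : nat -> R) (phi psi : nat -> R[i]).

Definition sqnorm psi : \bar R :=
  (\sum_(0 <= n <oo) (ComplexField.Normc.normc (psi n) ^+ 2)%:E)%E.

Definition l2 : set (nat -> R[i]) := [set psi | (sqnorm psi < +oo)%E].

(* Conjugate-linear in the first argument. *)
Definition inner phi psi : R[i] :=
  lim (series (fun n => (phi n)^* * psi n) @ \oo).

Definition delta (m : nat) : nat -> R[i] := fun n => (n == m)%:R.

Definition schroedinger V psi : nat -> R[i] :=
  fun n => psi n.+1 + (if n is m.+1 then psi m else 0) + (V n)%:C * psi n.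

Definition exp_partial_sum V (t : R) psi (N : nat) : nat -> R[i] :=
  fun n => \sum_(k < N)
    (- ('i * t%:C)) ^+ k / (k`!)%:R * iter k (schroedinger V) psi n.

(* e^{-itH} psi: the limit in the norm of l^2 of the exponential series, which
   converges when V is bounded, H being then a bounded operator. *)
Definition evolution V (t : R) psi : nat -> R[i] :=
  xget (fun=> 0) [set phi | l2 phi /\
    (fun N => sqnorm (fun n => exp_partial_sum V t psi N n - phi n)) @ \oo
      --> (0 : \bar R)].

Definition amplitude V (n : nat) (t : R) : R :=
  ComplexField.Normc.normc (inner (delta n) (evolution V t (delta 0))).

Definition outside_prob V (q T : R) : \bar R :=
  (\sum_(0 <= n <oo | (q < n.+1%:R)%R)
     ((2 / T)%:E * \int[@lebesgue_measure R]_(t in `[0%R, +oo[)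
        (amplitude V n t ^+ 2 * expR (- (2 * t / T)))%:E))%E.

(* outside_prob is finite (at most 1), so fine loses nothing. *)
Definition log_ratio V (a T : R) : \bar R :=
  (ln (fine (outside_prob V (T `^ a) T)) / ln T)%:E.

(* As ereal_sup set0 = -oo, the maximum with 0 gives the value 0 to the
   supremum of the empty set and changes nothing otherwise. *)
Definition alpha_l_plus V : \bar R :=
  Order.max 0%E (ereal_sup [set a%:E | a in
    [set a : R | 0 < a /\ limf_esup (log_ratio V a) +oo%R = 0%E]]).

Definition alpha_l_minus V : \bar R :=
  Order.max 0%E (ereal_sup [set a%:E | a in
    [set a : R | 0 < a /\ limf_einf (log_ratio V a) +oo%R = 0%E]]).

End Dynamics.

Section Periodic.
Variable R : realType.

Definition expi (k : R) : R[i] := cos k +i* sin k.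

(* For q = 2 the off-diagonal 1 and the corner entries fall in the same
   position and are added. *)
Definition floquet_matrix (V : nat -> R) (q : nat) (k : R) : 'M[R[i]]_q :=
  \matrix_(i < q, j < q)
    ((if i == j then (V i)%:C else 0)
     + (if (j == i.+1 :> nat) || (i == j.+1 :> nat) then 1 else 0)
     + (if (i == 0 :> nat) && (j == q.-1 :> nat) then expi (- k) else 0)
     + (if (i == q.-1 :> nat) && (j == 0 :> nat) then expi k else 0)).

(* Roots of the characteristic polynomial with multiplicity; taking the real
   part loses nothing for a Hermitian matrix. *)
Definition eigenvalues (n : nat) (A : 'M[R[i]]_n) : seq R :=
  sort <=%O
    [seq complex.Re z | z <- sval (closed_field_poly_normal (char_poly A))].

Definition band_edge (V : nat -> R) (q j : nat) (k : R) : R :=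
  nth 0 (eigenvalues (floquet_matrix V q k)) j.

Definition band_width (V : nat -> R) (q j : nat) : R :=
  `|band_edge V q j pi - band_edge V q j 0|.

Definition exponentially_growing (a : nat -> R) : Prop :=
  (ereal_sup [set (a n.+1 / a n)%:E | n in [set: nat]] < +oo)%E /\
  (1 < ereal_inf [set (a n.+1 / a n)%:E | n in [set: nat]])%E.

End Periodic.

(* Main.v *)
Require Import Defs.
From mathcomp Require Import all_boot all_order all_algebra perm fingroup.
From mathcomp Require Import complex ring lra zify.
From mathcomp Require Import all_classical all_reals all_analysis measurable_realfun.
Import Order.TTheory GRing.Theory Num.Theory.
Import numFieldNormedType.Exports.
Local Open Scope ring_scope.

(* For a polynomial [p] of degree at most q-1 the vector [p(H) delta_1] is
    supported on [[1,q]], so Duhamel's formula expresses the part of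
    [e^{-itH} p(H) delta_1] outside [[1,q]] by the same part of
    [e^{-isH} (H - x) p(H) delta_1], s <= t, for any real x, at the cost of a
    factor t.  Let A and B be the characteristic polynomials of H^q(0) and
    H^q(pi); they are D - 2 and D + 2 with D the discriminant, so B - A = 4.
    Replacing the roots of A by those of B one at a time writes 4 as a sum of q
    terms, each a difference b_{q,j} of roots times A with one factor removed
    and some roots moved.  Hence, with b = max_j b_{q,j}, the part of
    [e^{-itH} delta_1] outside [[1,q]] is at most q b t e^{2qbt} / 4 times that
    of [e^{-isH} A(H) delta_1].  The latter is O(1 + t): A(H) delta_1 equals
    delta_{q+1} - s(H) delta_1 - 2 delta_1, where s is the characteristic
    polynomial of the sites 2, ..., q-1, and s(H) delta_1 reaches the sites
    beyond q only through the bond (q-1, q), with a Duhamel kernel which is an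
    entry of a unitary group.  This gives P(q,T) = O(q^2 b^2 T^4) as long as
    q b T is small; with b = q^{-beta} and q = T^a this is a negative power of T
    for a > 3/beta, because a (beta - 1) > 2 when beta > 3.

    The group e^{-itH} is replaced by the Euler scheme (1 - i(t/m)H)^m on a
    large finite box, which turns all of this into finite algebra, and m is
    sent to infinity at the end. *)

Set Implicit Arguments.
Unset Strict Implicit.
Unset Printing Implicit Defensive.

(** * The discriminant as a continuant *)

Section Continuants.
Variable F : comNzRingType.
Implicit Types (v : nat -> F) (a b : F).

(* The characteristic polynomial of the tridiagonal matrix on the sites
   0, ..., n-1, paired with the one on the sites 0, ..., n-2. *)
Fixpoint continuant_pair v n : {poly F} * {poly F} :=
  if n is k.+1 then
    let c := continuant_pair v k in (('X - (v k)%:P) * c.1 - c.2, c.1)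
  else (1, 0).

Definition continuant v n := (continuant_pair v n).1.

Lemma continuant0 v : continuant v 0 = 1. Proof. by []. Qed.

Lemma continuant1 v : continuant v 1 = 'X - (v 0%N)%:P.
Proof. by rewrite /continuant /= mulr1 subr0. Qed.

Lemma continuantSS v n : continuant v n.+2 =
  ('X - (v n.+1)%:P) * continuant v n.+1 - continuant v n.
Proof. by []. Qed.

Lemma eq_continuant v w n : (forall k, (k < n)%N -> v k = w k) ->
  continuant v n = continuant w n.
Proof.
suff: (forall k, (k < n)%N -> v k = w k) ->
    continuant_pair v n = continuant_pair w n.
  by move=> h vw; rewrite /continuant h.
elim: n => [//|n IH] vw /=.
by rewrite IH ?vw // => k kn; apply: vw; rewrite ltnW.
Qed.

(** Expansion along the first site instead of the last: both sides obey the same second-order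
    recursion in n, hence the strong induction with two base cases. It allows a chain to be read
    from its right end. *)
Lemma continuant_shift v n : continuant v n.+2 =
  ('X - (v 0%N)%:P) * continuant (v \o succn) n.+1
  - continuant (v \o succn \o succn) n.
Proof.
elim/ltn_ind: n => -[|[|n]] IH.
- by rewrite !continuantSS !continuant1 !continuant0 /=; ring.
- by rewrite !continuantSS !continuant1 !continuant0 /=; ring.
rewrite (continuantSS v) (IH n.+1) // (IH n) //.
rewrite (continuantSS (v \o succn) n.+1) (continuantSS (v \o succn \o succn)) /=.
ring.
Qed.

(** Both continuants solve the same difference equation, the index of the second being shifted by
    one, so their Casoratian is constant and equals its value at n = 0. *)
Lemma continuant_wronskian v n :
  continuant v n.+2 * continuant (v \o succn) n
  - continuant v n.+1 * continuant (v \o succn) n.+1 = -1.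
Proof.
elim: n => [|n IH].
  by rewrite !continuantSS !continuant1 !continuant0 /=; ring.
rewrite -IH (continuantSS v n.+1) [continuant (_ \o _) n.+2]continuantSS /=.
ring.
Qed.

Lemma monic_size_continuant v n :
  size (continuant v n) = n.+1 /\ continuant v n \is monic.
Proof.
elim/ltn_ind: n => -[|[|n]] IH.
- by rewrite continuant0 size_poly1 monic1.
- by rewrite continuant1 size_XsubC monicXsubC.
have [s1 m1] := IH n.+1 (ltnSn _).
have [s0 _] := IH n (leqnSn _).
have sM : size (('X - (v n.+1)%:P) * continuant v n.+1) = n.+3.
  by rewrite size_monicM ?monicXsubC ?monic_neq0 // size_XsubC s1.
have lt : (size (- continuant v n)%R < size (('X - (v n.+1)%:P) * continuant v n.+1)%R)%N.
  by rewrite sM size_polyN s0.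
rewrite continuantSS; split; first by rewrite size_polyDl.
by rewrite monicE lead_coefDl // -monicE monicMl ?monicXsubC.
Qed.

Lemma size_continuant v n : size (continuant v n) = n.+1.
Proof. by have [] := monic_size_continuant v n. Qed.

Lemma continuant_monic v n : continuant v n \is monic.
Proof. by have [] := monic_size_continuant v n. Qed.

(** The summands follow those of [floquet_matrix], so for n = 2 the corner entries again add to the
    off-diagonal ones. Free corners a and b cover both band edges at once. *)
Definition corner_jacobi v a b n : 'M[F]_n :=
  \matrix_(i < n, j < n)
    ((if i == j then v i else 0)
     + (if (j == i.+1 :> nat) || (i == j.+1 :> nat) then 1 else 0)
     + (if (i == 0 :> nat) && (j == n.-1 :> nat) then a else 0)
     + (if (i == n.-1 :> nat) && (j == 0 :> nat) then b else 0)).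

Lemma sum_delta_ord (V : nmodType) m k (f : nat -> V) :
  \sum_(j < m) (if j == k :> nat then f j else 0) = if (k < m)%N then f k else 0.
Proof.
case: ltnP => km.
  rewrite (bigD1 (Ordinal km)) //= eqxx big1 ?addr0 // => j.
  by rewrite -val_eqE /= => /negPf->.
by rewrite big1 // => j _; case: eqP => // e; move: (ltn_ord j); rewrite e ltnNge km.
Qed.

(** Turns a product with X - J into a difference equation with boundary terms, so that columns built
    from its solutions are annihilated except in the first and last rows. *)
Lemma char_corner_jacobi_mul v a b n (f : nat -> {poly F}) (i : 'I_n.+2) :
  \sum_(j < n.+2) char_poly_mx (corner_jacobi v a b n.+2) i j * f j =
  ('X - (v i)%:P) * f i - (if (i < n.+1)%N then f i.+1 else 0)
  - (if (0 < i)%N then f i.-1 else 0)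
  - (if i == 0 :> nat then a%:P * f n.+1 else 0)
  - (if i == n.+1 :> nat then b%:P * f 0%N else 0).
Proof.
transitivity (\sum_(j < n.+2)
  ((if j == i :> nat then ('X - (v i)%:P) * f j else 0)
   - (if j == i.+1 :> nat then f j else 0)
   - (if (0 < i)%N then if j == i.-1 :> nat then f j else 0 else 0)
   - (if i == 0 :> nat then if j == n.+1 :> nat then a%:P * f j else 0 else 0)
   - (if i == n.+1 :> nat then if j == 0 :> nat then b%:P * f j else 0 else 0))).
  apply: eq_bigr => j _; rewrite !mxE -!(inj_eq val_inj) /=.
  have -> : (if (j == i.+1 :> nat) || (i == j.+1 :> nat) then 1 else 0 : F) =
    (if j == i.+1 :> nat then 1 else 0) +
    (if (0 < i)%N then if j == i.-1 :> nat then 1 else 0 else 0).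
    case: (nat_of_ord i) => [|k]; first by rewrite orbF addr0.
    rewrite eqSS (eq_sym k); case: eqP => [->|_]; last by rewrite add0r.
    by rewrite -[X in _ == X]addn0 -addn2 eqn_add2l addr0.
  rewrite (eq_sym (nat_of_ord i) j) !rmorphD /= !opprD !addrA !mulrDl !mulNr.
  do 4?congr (_ - _).
  - by case: eqP => _; rewrite ?polyC0 ?mulrBl ?mulr1n // mulr0n !mul0r subr0.
  - by case: eqP => _; rewrite ?polyC0 ?mul0r // polyC1 mul1r.
  - by case: ifP => _; [case: eqP => _|]; rewrite ?polyC0 ?mul0r // polyC1 mul1r.
  - by case: (i == 0 :> nat); [case: eqP => _|]; rewrite ?polyC0 ?mul0r.
  - by case: (i == _ :> nat); [case: eqP => _|]; rewrite ?polyC0 ?mul0r.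
rewrite !big_split /= !sumrN.
congr (_ - _ - _ - _ - _).
- by rewrite (sum_delta_ord _ _ (fun j => ('X - (v i)%:P) * f j)) ltn_ord.
- by rewrite (sum_delta_ord _ _ f) ltnS.
- case: ltnP => i0; last by rewrite big1.
  by rewrite (sum_delta_ord _ _ f) (leq_ltn_trans (leq_pred _) (ltn_ord i)).
- case: eqP => _; last by rewrite big1.
  by rewrite (sum_delta_ord _ _ (fun j => a%:P * f j)) ltnSn.
- case: eqP => _; last by rewrite big1.
  by rewrite (sum_delta_ord _ _ (fun j => b%:P * f j)).
Qed.

Lemma det_mx22 (K : comNzRingType) (A : 'M[K]_2) :
  \det A = A 0 0 * A 1 1 - A 0 1 * A 1 0.
Proof.
rewrite (expand_det_row _ 0) !big_ord_recl big_ord0 /cofactor !det_mx11 !mxE.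
have -> : lift 0 0 = 1 :> 'I_2 by apply: val_inj.
have -> : lift 1 0 = 0 :> 'I_2 by apply: val_inj.
by rewrite addr0 /= expr0 mul1r expr1 mulN1r mulrN.
Qed.

(* The first two columns of the unitriangular matrix [Q] are the fundamental
   solutions of the difference equation, so that [C *m Q] becomes block
   triangular once its last row is moved to the second place; the sign of this
   permutation is recovered from monicity. *)
Lemma char_poly_corner_jacobi v a b n : a * b = 1 ->
  char_poly (corner_jacobi v a b n.+2) =
  continuant v n.+2 - continuant (v \o succn) n - (a + b)%:P.
Proof.
move=> ab1.
pose w := v \o succn; pose C := char_poly_mx (corner_jacobi v a b n.+2).
pose g k := if k is l.+1 then continuant w l else 0.
pose Q : 'M[{poly F}]_n.+2 := \matrix_(i, j)
  if j == 0 :> nat then continuant v i else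
  if j == 1 :> nat then g i else (i == j)%:R.
have detQ : \det Q = 1.
  rewrite det_trig.
    rewrite big1 // => -[[|[|k]] kn] _; rewrite mxE //= eqxx //.
  apply/is_trig_mxP => i j ij; rewrite mxE.
  case: (nat_of_ord j =P 0%N) ij => [->//|_ ij]; case: eqP => [e|_]; last first.
    by rewrite -val_eqE /= ltn_eqF.
  by move: ij; rewrite e; case: (nat_of_ord i).
pose R := C *m Q.
have R0 i : R i 0 = (if i == 0 :> nat then - a%:P * continuant v n.+1 else 0)
   + (if i == n.+1 :> nat then continuant v n.+2 - b%:P else 0).
  rewrite mxE (eq_bigr (fun j : 'I_n.+2 => C i j * continuant v j)); last first.
    by move=> j _; rewrite [Q _ _]mxE.
  rewrite char_corner_jacobi_mul.
  have := ltn_ord i; case: (nat_of_ord i) => [|k] /=.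
    by move=> _; rewrite continuant0 continuant1; ring.
  rewrite !ltnS eqSS => kn; case: eqP kn => [->|ne] kn.
    by rewrite ltnn continuantSS continuant0; ring.
  by rewrite ltn_neqAle kn (introN eqP ne) /= continuantSS; ring.
have R1 i : R i 1 = (if i == 0 :> nat then - 1 - a%:P * continuant w n else 0)
   + (if i == n.+1 :> nat then continuant w n.+1 else 0).
  rewrite mxE (eq_bigr (fun j : 'I_n.+2 => C i j * g j)); last first.
    by move=> j _; rewrite [Q _ _]mxE.
  rewrite char_corner_jacobi_mul.
  have := ltn_ord i; case: (nat_of_ord i) => [|k] /=.
    by move=> _; rewrite continuant0; ring.
  rewrite !ltnS eqSS => kn; case: eqP kn => [->|ne] kn.
    rewrite ltnn; case: (n) => [|l]; rewrite /= ?continuantSS ?continuant1 ?continuant0 /w /=; ring.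
  rewrite ltn_neqAle kn (introN eqP ne) /=; case: (k) => [|l].
    by rewrite /= continuant0 continuant1 /w /=; ring.
  by rewrite /= continuantSS /w /=; ring.
have R2 i (j : 'I_n.+2) : (1 < j)%N -> R i j = C i j.
  move=> j1; rewrite mxE (bigD1 j) //= big1 => [|k kj].
    rewrite addr0 [Q _ _]mxE; case: eqP => [e|_]; first by rewrite e in j1.
    by case: eqP => [e|_]; rewrite ?eqxx ?mulr1 //; rewrite e in j1.
  rewrite [Q _ _]mxE; case: eqP => [e|_]; first by rewrite e in j1.
  by case: eqP => [e|_]; [rewrite e in j1|rewrite (negPf kj) mulr0].
pose pi_ (i : 'I_n.+2) : 'I_n.+2 :=
  inord (if i == 0 :> nat then 0%N else if i == 1 :> nat then n.+1 else i.-1).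
have pi_val i : pi_ i =
    (if i == 0 :> nat then 0%N else if i == 1 :> nat then n.+1 else i.-1) :> nat.
  rewrite inordK //; have := ltn_ord i.
  by case: (nat_of_ord i) => [|[|k]] //= kn; rewrite ltnW.
have pi_inj : injective pi_.
  move=> i j /(congr1 val) /=; rewrite !pi_val => e; apply: val_inj => /=.
  have := ltn_ord i; have := ltn_ord j; move: e.
  by case: (nat_of_ord i) => [|[|k]]; case: (nat_of_ord j) => [|[|l]] //=; lia.
pose s := perm pi_inj.
pose B : 'M[{poly F}]_(2 + n) := row_perm s R.
have detB : \det B = (-1) ^+ s * char_poly (corner_jacobi v a b n.+2).
  by rewrite /B row_permE det_mulmx det_perm det_mulmx detQ mulr1.
have detUL : \det (ulsubmx B) =
    continuant v n.+2 - continuant w n - (a + b)%:P.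
  have ulE i j : ulsubmx B i j = R (pi_ (lshift n i)) (lshift n j).
    by do 3!rewrite [LHS]mxE; rewrite permE.
  rewrite det_mx22 !ulE.
  set i0 := pi_ _; set i1 := pi_ _.
  have e0 : i0 = 0%N :> nat by rewrite pi_val.
  have e1 : i1 = n.+1 :> nat by rewrite pi_val.
  have -> : lshift n 0 = 0 :> 'I_(2 + n) by apply: val_inj.
  have -> : lshift n 1 = 1 :> 'I_(2 + n) by apply: val_inj.
  rewrite !R0 !R1 e0 e1 !eqxx /= !addr0 !add0r.
  have := continuant_wronskian v n; rewrite -/w => W.
  have ab1P : a%:P * b%:P = 1 by rewrite -polyCM ab1.
  transitivity (continuant v n.+2 - b%:P + a%:P * (continuant v n.+2 * continuant w n
     - continuant v n.+1 * continuant w n.+1) - a%:P * b%:P * continuant w n).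
    by ring.
  by rewrite W ab1P polyCD; ring.
have dl0 : dlsubmx B = 0.
  apply/matrixP => i j; do 3!rewrite [LHS]mxE; rewrite permE [RHS]mxE.
  set k := pi_ _.
  have ek : k = i.+1 :> nat by rewrite pi_val.
  have -> : lshift n j = if j == 0 then 0 else 1 :> 'I_(2 + n).
    by apply: val_inj; case: j => -[|[|j]] jn.
  have kn : (k == n.+1 :> nat) = false by rewrite ek eqSS ltn_eqF.
  by case: eqP => _; rewrite ?R0 ?R1 kn ek /= addr0.
have detDR : \det (drsubmx B) = (-1) ^+ n.
  (* The row shift brings the entries -1 of the superdiagonal of [C] onto the diagonal and leaves
     zeros above it; the entries below do not affect the determinant. *)
  have drE (i j : 'I_n) : drsubmx B i j =
      - (if i == j :> nat then 1 else 0)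
      + (if (j < i)%N then drsubmx B i j else 0).
    have [ji|ij] := ltnP j i; first by rewrite gtn_eqF // oppr0 add0r.
    rewrite addr0; do 3!rewrite [LHS]mxE; rewrite permE R2 //.
    set k := pi_ _.
    have ek : k = i.+1 :> nat by rewrite pi_val.
    rewrite !mxE -!(inj_eq val_inj) /= ek /=.
    have -> : (i.+1 == 2 + j)%N = false by lia.
    have -> : (i.+1 == (2 + j).+1)%N = false by lia.
    have -> : (2 + j == i.+2)%N = (i == j :> nat) by lia.
    rewrite andbF orbF !addr0 sub0r add0r.
    by case: eqP => _; rewrite ?polyC1 ?polyC0.
  rewrite det_trig.
    rewrite (eq_bigr (fun=> -1)) ?prodr_const ?card_ord // => i _.
    by rewrite drE eqxx ltnn addr0.
  apply/is_trig_mxP => i j ij.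
  by rewrite drE (ltn_eqF ij) ltnNge (ltnW ij) oppr0 addr0.
pose X := continuant v n.+2 - continuant w n - (a + b)%:P.
have XM : X \is monic.
  have lt : (size (- continuant w n - (a + b)%:P)%R < size (continuant v n.+2))%N.
    rewrite size_continuant ltnS (leq_trans (size_polyD _ _)) // geq_max.
    rewrite !size_polyN size_continuant leqnSn /=.
    by rewrite (leq_trans (size_polyC_leq1 _)).
  by rewrite monicE /X -addrA lead_coefDl // -monicE continuant_monic.
have : char_poly (corner_jacobi v a b n.+2) = (-1) ^+ (s + n) * X.
  have dB : \det B = X * (-1) ^+ n by rewrite -[B]submxK dl0 det_ublock detUL detDR.
  rewrite exprD -mulrA [_ ^+ n * X]mulrC -dB detB mulrA -exprD addnn -mul2n exprM.
  by rewrite sqrrN expr1n expr1n mul1r.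
(* If the sign is -1, monicity of both sides gives -1 = 1 in F, so the sign makes no difference. *)
rewrite -signr_odd; case: (odd _); last by rewrite expr0 mul1r.
rewrite expr1 mulN1r => e; rewrite e.
have : lead_coef (- X) = 1 by rewrite -e; apply/monicP/char_poly_monic.
rewrite lead_coefN (monicP XM) => N1.
by rewrite -[RHS]mul1r -polyC1 -N1 polyCN mulN1r.
Qed.

End Continuants.

(** * Eigenvalues of the Floquet matrices *)

Section RealSymmetric.
Local Open Scope complex_scope.
Variable R : realType.

(** For an eigenvector u of eigenvalue z, z times the squared norm of u is u A conj(u)^T, which is
    its own conjugate because A is real and symmetric; the norm is nonzero, so z is real. *)
Lemma root_char_poly_sym n (S : 'M[R]_n) (z : R[i]) : S^T = S ->
  root (char_poly (map_mx (real_complex R) S)) z -> (complex.Re z)%:C = z.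
Proof.
move=> Ssym; rewrite -eigenvalue_root_char => /eigenvalueP[u uA u0].
pose A := map_mx (real_complex R) S.
pose w := map_mx (@conjc R) u.
have Aconj : map_mx (@conjc R) A = A.
  by apply/matrixP => i j; rewrite !mxE conjc_real.
have Asym : A^T = A by rewrite map_trmx Ssym.
have conj_w : map_mx (@conjc R) w = u.
  by apply/matrixP => i j; rewrite !mxE conjcK.
pose N := (u *m w^T) 0 0.
have e : z * N = (u *m A *m w^T) 0 0 by rewrite uA -scalemxAl mxE.
have N0 : N != 0.
  apply: contra u0 => /eqP; rewrite /N mxE => /eqP.
  rewrite psumr_eq0 => [/allP h|i _]; last by rewrite !mxE mulcJ_ge0.
  apply/eqP/rowP => j; have := h j (mem_index_enum _).
  by rewrite !mxE mulf_eq0 conjc_eq0 orbb => /eqP.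
have NJ : conjc N = N.
  rewrite /N !mxE rmorph_sum; apply: eq_bigr => j _.
  by rewrite !mxE rmorphM /= conjcK mulrC.
have : conjc (z * N) = z * N.
  have conjE (M : 'M[R[i]]_1) : conjc (M 0 0) = (map_mx (@conjc R) M) 0 0.
    by rewrite mxE.
  rewrite e conjE.
  rewrite !map_mxM -map_trmx conj_w Aconj -/w.
  have -> : w *m A *m u^T = (u *m A *m w^T)^T by rewrite !trmx_mul trmxK Asym mulmxA.
  by rewrite [LHS]mxE.
rewrite rmorphM /= NJ => /(mulIf N0).
by case: z {uA e} => a b /= [] b0; congr (_ +i* _); lra.
Qed.

(** The roots being real, the real parts taken in [eigenvalues] lose nothing, and sorting only
    permutes the factors. *)
Lemma prod_eigenvalues n (S : 'M[R]_n) :  S^T = S ->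
  \prod_(j < n) ('X - (nth 0 (eigenvalues (map_mx (real_complex R) S)) j)%:C%:P) =
  char_poly (map_mx (real_complex R) S).
Proof.
move=> Ssym; rewrite /eigenvalues; case: closed_field_poly_normal => r /=.
rewrite (monicP (char_poly_monic _)) scale1r => e.
set s := sort _ _.
have sz : size s = n.
  rewrite size_sort size_map; apply: succn_inj.
  by rewrite -(size_prod_XsubC r id) -e size_char_poly.
transitivity (\prod_(x <- s) ('X - x%:C%:P)).
  by rewrite (big_nth 0) sz big_mkord.
rewrite (perm_big _ (permEl (perm_sort _ _))) big_map [RHS]e.
rewrite big_seq [RHS]big_seq; apply: eq_bigr => z zr.
by rewrite (root_char_poly_sym Ssym) // e root_prod_XsubC.
Qed.

(** Meant for k = 0 and k = pi, where the corners are 1 and -1. The first form feeds the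
    discriminant formula, the second the reality of the eigenvalues. *)
Lemma floquet_real (V : nat -> R) q (c k : R) : expi k = c%:C -> expi (- k) = c%:C ->
  floquet_matrix V q k = corner_jacobi (fun n => (V n)%:C) c%:C c%:C q /\
  floquet_matrix V q k = map_mx (real_complex R) (corner_jacobi V c c q).
Proof.
move=> ek eNk; split; apply/matrixP => i j; rewrite !mxE ek eNk //.
by rewrite !rmorphD /= !(fun_if (real_complex R)) !rmorph1 !rmorph0.
Qed.

Lemma prod_band_edge (V : nat -> R) q (c k : R) : expi k = c%:C -> expi (- k) = c%:C ->
  \prod_(j < q) ('X - (band_edge V q j k)%:C%:P) =
  char_poly (corner_jacobi (fun n => (V n)%:C) c%:C c%:C q).
Proof.
move=> ek eNk; have [<- e] := floquet_real V q ek eNk.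
rewrite /band_edge e prod_eigenvalues //.
apply/matrixP => i j; rewrite !mxE (eq_sym j) (orbC (_ == _.+1)).
case: eqP => [->|_]; rewrite ?addrA -!addrA; congr (_ + (_ + _));
by rewrite addrC (andbC (j == _ :> nat)) (andbC (j == _ :> nat)).
Qed.

(** The difference of the two continuants is the discriminant D; this product is A = D - 2, and its
    analogue at pi is B = D + 2. *)
Lemma prod_band_edge0 (V : nat -> R) q :
  \prod_(j < q.+2) ('X - (band_edge V q.+2 j 0)%:C%:P) =
  continuant (fun n => (V n)%:C) q.+2 - continuant (fun n => (V n.+1)%:C) q - 2%:P.
Proof.
have e : expi 0 = (1 : R)%:C by rewrite /expi cos0 sin0.
by rewrite (prod_band_edge _ _ e) ?oppr0 // char_poly_corner_jacobi ?mulr1.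
Qed.

Lemma prod_band_edgepi (V : nat -> R) q :
  \prod_(j < q.+2) ('X - (band_edge V q.+2 j pi)%:C%:P) =
  continuant (fun n => (V n)%:C) q.+2 - continuant (fun n => (V n.+1)%:C) q + 2%:P.
Proof.
have e : expi pi = (-1 : R)%:C by rewrite /expi cospi sinpi.
rewrite (prod_band_edge _ _ e); last by rewrite /expi cosN sinN cospi sinpi oppr0.
rewrite char_poly_corner_jacobi; last by rewrite rmorphN rmorph1 mulrNN mulr1.
by rewrite rmorphN rmorph1 -opprD polyCN opprK.
Qed.

End RealSymmetric.

(** * The Euler step on a finite-dimensional space *)

Local Notation normc := ComplexField.Normc.normc.

Section EuclideanNorm.
Local Open Scope complex_scope.
Variable R : rcfType.
Implicit Types (z w : R[i]).

Lemma normc_sqr z : normc z ^+ 2 = complex.Re z ^+ 2 + complex.Im z ^+ 2.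
Proof. by case: z => a b /=; rewrite sqr_sqrtr // addr_ge0 ?sqr_ge0. Qed.

Lemma normc_ge0 z : 0 <= normc z.
Proof. by case: z => a b /=; rewrite sqrtr_ge0. Qed.

Lemma normc_real (x : R) : normc x%:C = `|x|.
Proof. by rewrite /= expr0n addr0 sqrtr_sqr. Qed.

Lemma Re_sum (I : Type) (r : seq I) (F : I -> R[i]) :
  complex.Re (\sum_(i <- r) F i) = \sum_(i <- r) complex.Re (F i).
Proof.
elim: r => [|a r IH]; first by rewrite !big_nil.
by rewrite !big_cons -IH; case: (F a) => x y; case: (\sum_(_ <- _) F _).
Qed.

Lemma Im_sum (I : Type) (r : seq I) (F : I -> R[i]) :
  complex.Im (\sum_(i <- r) F i) = \sum_(i <- r) complex.Im (F i).
Proof.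
elim: r => [|a r IH]; first by rewrite !big_nil.
by rewrite !big_cons -IH; case: (F a) => x y; case: (\sum_(_ <- _) F _).
Qed.

Lemma normcX z n : normc (z ^+ n) = normc z ^+ n.
Proof.
elim: n => [|n IH]; first exact: ComplexField.Normc.normc1.
by rewrite !exprS ComplexField.Normc.normcM IH.
Qed.

Lemma le_normc_sum (I : Type) (r : seq I) (F : I -> R[i]) :
  normc (\sum_(i <- r) F i) <= \sum_(i <- r) normc (F i).
Proof.
elim: r => [|a r IH]; first by rewrite !big_nil ComplexField.Normc.normc0.
by rewrite !big_cons (le_trans (le_normcD _ _)) // lerD2l.
Qed.

Lemma cauchy_schwarz_sum (I : finType) (a b : I -> R) :
  (\sum_i a i * b i) ^+ 2 <= (\sum_i a i ^+ 2) * (\sum_i b i ^+ 2).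
Proof.
set A := \sum_i a i ^+ 2; set B := \sum_i b i ^+ 2; set D := \sum_i a i * b i.
have key x y : 0 <= x ^+ 2 * A - 2 * (x * y) * D + y ^+ 2 * B.
  suff -> : x ^+ 2 * A - 2 * (x * y) * D + y ^+ 2 * B =
      \sum_i (x * a i - y * b i) ^+ 2 by apply: sumr_ge0 => i _; exact: sqr_ge0.
  rewrite !mulr_sumr -sumrB -big_split /=; apply: eq_bigr => i _; ring.
have A0 : 0 <= A by apply: sumr_ge0 => i _; exact: sqr_ge0.
have [A00|A1] := eqVneq A 0; last first.
  have {}A0 : 0 < A by rewrite lt_def A1.
  (* At x = D, y = A the quadratic form equals A (A B - D^2), and A > 0. *)
  have := key D A.
  have -> : D ^+ 2 * A - 2 * (D * A) * D + A ^+ 2 * B = A * (A * B - D ^+ 2) by ring.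
  by rewrite pmulr_rge0 // subr_ge0.
have -> : D = 0.
  rewrite /D big1 // => i _.
  have /psumr_eq0P/(_ i isT)/eqP := A00.
  by rewrite sqrf_eq0 => h; rewrite (eqP (h _)) ?mul0r // => j _; exact: sqr_ge0.
by rewrite A00 expr0n mul0r.
Qed.

Definition nrm n (u : 'cV[R[i]]_n) : R := Num.sqrt (\sum_i normc (u i 0) ^+ 2).

Lemma sum_normc_ge0 n (u : 'cV[R[i]]_n) : 0 <= \sum_i normc (u i 0) ^+ 2.
Proof. by apply: sumr_ge0 => i _; exact: sqr_ge0. Qed.

Lemma nrm_ge0 n (u : 'cV[R[i]]_n) : 0 <= nrm u.
Proof. exact: sqrtr_ge0. Qed.

Lemma nrm_sqr n (u : 'cV[R[i]]_n) : nrm u ^+ 2 = \sum_i normc (u i 0) ^+ 2.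
Proof. by rewrite sqr_sqrtr // sum_normc_ge0. Qed.

Lemma nrm0 n : nrm (0 : 'cV[R[i]]_n) = 0.
Proof.
by rewrite /nrm big1 ?sqrtr0 // => i _; rewrite mxE ComplexField.Normc.normc0 expr0n.
Qed.

Lemma nrmZ n z (u : 'cV[R[i]]_n) : nrm (z *: u) = normc z * nrm u.
Proof.
rewrite /nrm -[normc z]ger0_norm ?normc_ge0 // -sqrtr_sqr -sqrtrM ?sqr_ge0 //.
congr (Num.sqrt _); rewrite mulr_sumr; apply: eq_bigr => i _.
by rewrite mxE ComplexField.Normc.normcM exprMn.
Qed.

Lemma nrmD n (u w : 'cV[R[i]]_n) : nrm (u + w) <= nrm u + nrm w.
Proof.
rewrite -(ler_pXn2r (n := 2)) ?nnegrE ?addr_ge0 ?nrm_ge0 // sqrrD !nrm_sqr.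
apply: (@le_trans _ _ (\sum_i (normc (u i 0) + normc (w i 0)) ^+ 2)).
  apply: ler_sum => i _; rewrite mxE.
  by rewrite ler_pXn2r ?nnegrE ?addr_ge0 ?normc_ge0 // le_normcD.
rewrite (eq_bigr (fun i => normc (u i 0) ^+ 2 + normc (u i 0) * normc (w i 0) *+ 2
   + normc (w i 0) ^+ 2)); last by move=> i _; rewrite sqrrD.
rewrite !big_split /= lerD2r lerD2l -mulr2n lerMn2r /=.
apply: (le_trans (ler_norm _)).
rewrite -(ler_pXn2r (n := 2)) ?nnegrE ?normr_ge0 ?mulr_ge0 ?nrm_ge0 //.
by rewrite real_normK ?num_real // exprMn !nrm_sqr cauchy_schwarz_sum.
Qed.

Lemma nrm_sum n (I : Type) (r : seq I) (F : I -> 'cV[R[i]]_n) :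
  nrm (\sum_(i <- r) F i) <= \sum_(i <- r) nrm (F i).
Proof.
elim: r => [|a r IH]; first by rewrite !big_nil nrm0.
by rewrite !big_cons (le_trans (nrmD _ _)) // lerD2l.
Qed.

Lemma normc_le_nrm n (u : 'cV[R[i]]_n) i : normc (u i 0) <= nrm u.
Proof.
rewrite -(ler_pXn2r (n := 2)) ?nnegrE ?normc_ge0 ?nrm_ge0 // nrm_sqr.
rewrite (bigD1 i) //= lerDl; apply: sumr_ge0 => j _; exact: sqr_ge0.
Qed.

(* Schur's test; by symmetry of [S] its column sums are its row sums. *)
Lemma nrm_mulmx_real n (S : 'M[R]_n) (K : R) (u : 'cV[R[i]]_n) : S^T = S ->
  (forall i, \sum_j `|S i j| <= K) ->
  nrm (map_mx (real_complex R) S *m u) <= K * nrm u.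
Proof.
case: n S u => [S u _ _|n S u Ssym SK].
  by rewrite /nrm !big_ord0 sqrtr0 mulr0.
have K0 : 0 <= K by apply: le_trans (SK ord0); exact: sumr_ge0.
rewrite -(ler_pXn2r (n := 2)) ?nnegrE ?mulr_ge0 ?nrm_ge0 // exprMn !nrm_sqr.
have row i : normc ((map_mx (real_complex R) S *m u) i 0) ^+ 2 <=
    K * \sum_j `|S i j| * normc (u j 0) ^+ 2.
  apply: (@le_trans _ _ ((\sum_j Num.sqrt `|S i j| * (Num.sqrt `|S i j| * normc (u j 0))) ^+ 2)).
    rewrite ler_pXn2r ?nnegrE ?normc_ge0 //; last first.
      by apply: sumr_ge0 => j _; rewrite !mulr_ge0 ?sqrtr_ge0 ?normc_ge0.
    rewrite mxE (le_trans (le_normc_sum _ _)) // ler_sum // => j _.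
    rewrite ComplexField.Normc.normcM mxE normc_real mulrA -expr2 sqr_sqrtr //.
  apply: (le_trans (cauchy_schwarz_sum _ _)).
  apply: ler_pM.
  - by apply: sumr_ge0 => j _; exact: sqr_ge0.
  - by apply: sumr_ge0 => j _; exact: sqr_ge0.
  - by apply: le_trans (SK i); apply: ler_sum => j _; rewrite sqr_sqrtr.
  - by apply: ler_sum => j _; rewrite exprMn sqr_sqrtr.
apply: (le_trans (ler_sum _ (fun i _ => row i))).
rewrite -mulr_sumr exchange_big /= expr2 -mulrA ler_wpM2l // mulr_sumr.
apply: ler_sum => j _; rewrite -mulr_suml ler_wpM2r ?sqr_ge0 //.
by apply: le_trans (SK j); apply: ler_sum => i _; rewrite -[in X in X <= _]Ssym mxE.
Qed.

Definition euler_step n (t : R) (H : 'M[R[i]]_n) : 'M[R[i]]_n :=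
  1%:M - ('i * t%:C) *: H.

(** The cross term is proportional to the imaginary part of <u, H u>, which vanishes for real
    symmetric S. There remains |u|^2 + t^2 |H u|^2, so m steps of length t/m cost only a factor
    tending to 1. *)
Lemma nrm_euler_step n (t : R) (S : 'M[R]_n) (K : R) (u : 'cV[R[i]]_n) : S^T = S ->
  (forall i, \sum_j `|S i j| <= K) ->
  nrm (euler_step t (map_mx (real_complex R) S) *m u) <=
  Num.sqrt (1 + (t * K) ^+ 2) * nrm u.
Proof.
move=> Ssym SK; set H := map_mx _ _.
have c0 : 0 <= 1 + (t * K) ^+ 2 by rewrite addr_ge0 // sqr_ge0.
rewrite -(ler_pXn2r (n := 2)) ?nnegrE ?mulr_ge0 ?sqrtr_ge0 ?nrm_ge0 //.
rewrite [(_ * nrm u) ^+ 2]exprMn (sqr_sqrtr c0) mulrDl mul1r exprMn -mulrA -exprMn.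
have HK : (nrm (H *m u)) ^+ 2 <= (K * nrm u) ^+ 2.
  have h := nrm_mulmx_real u Ssym SK.
  by rewrite ler_pXn2r ?nnegrE ?nrm_ge0 // (le_trans _ h) ?nrm_ge0.
apply: le_trans (lerD (lexx _) (ler_wpM2l (sqr_ge0 t) HK)).
set w := H *m u.
have -> : euler_step t H *m u = u - ('i * t%:C) *: w.
  by rewrite mulmxBl mul1mx scalemxAl.
rewrite !nrm_sqr.
have e i : normc ((u - ('i * t%:C) *: w) i 0) ^+ 2 =
   normc (u i 0) ^+ 2 + t ^+ 2 * normc (w i 0) ^+ 2
   + 2 * t * (complex.Re (u i 0) * complex.Im (w i 0)
              - complex.Im (u i 0) * complex.Re (w i 0)).
  rewrite !normc_sqr !mxE.
  by case: (u i 0) => a b; case: (\sum_j _) => c d /=; ring.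
rewrite (eq_bigr _ (fun i _ => e i)) !big_split /= -!mulr_sumr.
suff -> : \sum_i (complex.Re (u i 0) * complex.Im (w i 0)
          - complex.Im (u i 0) * complex.Re (w i 0)) = 0 by rewrite mulr0 addr0.
have ReM (x : R) (z : R[i]) : complex.Re (x%:C * z) = x * complex.Re z.
  by case: z => a b /=; ring.
have ImM (x : R) (z : R[i]) : complex.Im (x%:C * z) = x * complex.Im z.
  by case: z => a b /=; ring.
rewrite sumrB; apply/eqP; rewrite subr_eq0; apply/eqP.
transitivity (\sum_i \sum_j S i j * (complex.Re (u i 0) * complex.Im (u j 0))).
  apply: eq_bigr => i _; rewrite mxE Im_sum mulr_sumr.
  by apply: eq_bigr => j _; rewrite mxE ImM; ring.
rewrite exchange_big; apply: eq_bigr => i _.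
rewrite mxE Re_sum mulr_sumr.
by apply: eq_bigr => j _; rewrite mxE ReM -[in LHS]Ssym mxE; ring.
Qed.

End EuclideanNorm.

(** * Propagation estimates by the discrete Duhamel formula *)

Lemma horner_mx_XsubCM (F : comNzRingType) n (A : 'M[F]_n.+1) (c : F) (p : {poly F}) :
  horner_mx A (('X - c%:P) * p) = (A - c%:M) *m horner_mx A p.
Proof. by rewrite rmorphM rmorphB /= horner_mx_X horner_mx_C. Qed.

Section Duhamel.
Local Open Scope complex_scope.
Variables (R : rcfType) (n : nat) (P H : 'M[R[i]]_n.+1) (tau c : R) (m : nat).
Hypothesis tau_ge0 : 0 <= tau.
Hypothesis c_ge1 : 1 <= c.
Hypothesis nrmP : forall u : 'cV_n.+1, nrm (P *m u) <= nrm u.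
Hypothesis nrmW : forall u : 'cV_n.+1, nrm (euler_step tau H *m u) <= c * nrm u.
Implicit Types (u chi : 'cV[R[i]]_n.+1) (s x : R).

Let W := euler_step tau H.

(** Uniform in the number of steps up to m, so that the bound reproduces itself under Duhamel sums,
    whose inner times also lie below m. *)
Definition outer_bound chi s :=
  forall k, (k <= m)%N -> nrm (P *m (W ^+ k *m chi)) <= s.

Lemma nrm_euler_iter k u : (k <= m)%N -> nrm (W ^+ k *m u) <= c ^+ m * nrm u.
Proof.
move=> km; apply: (@le_trans _ _ (c ^+ k * nrm u)).
  elim: k {km} => [|k IH]; first by rewrite !expr0 mul1mx mul1r.
  rewrite !exprS -mulmxA (le_trans (nrmW _)) // -mulrA ler_wpM2l //.
  exact: le_trans c_ge1.
by rewrite ler_wpM2r ?nrm_ge0 // ler_weXn2l.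
Qed.

Lemma outer_bound_nrm chi : outer_bound chi (c ^+ m * nrm chi).
Proof. by move=> k km; rewrite (le_trans (nrmP _)) // nrm_euler_iter. Qed.

Lemma outer_boundD chi chi' s s' :
  outer_bound chi s -> outer_bound chi' s' -> outer_bound (chi + chi') (s + s').
Proof.
move=> h h' k km; rewrite !mulmxDr (le_trans (nrmD _ _)) // lerD //.
  exact: h.
exact: h'.
Qed.

Lemma outer_boundZ chi s z : outer_bound chi s -> outer_bound (z *: chi) (normc z * s).
Proof.
by move=> h k km; rewrite -!scalemxAr nrmZ ler_wpM2l ?normc_ge0 // h.
Qed.

Lemma outer_bound_sum (I : Type) (r : seq I) (F : I -> 'cV[R[i]]_n.+1) (s : I -> R) :
  (forall i, outer_bound (F i) (s i)) ->
  outer_bound (\sum_(i <- r) F i) (\sum_(i <- r) s i).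
Proof.
move=> h; elim: r => [|a r IH].
  by move=> k km; rewrite !big_nil !mulmx0 nrm0.
by rewrite !big_cons; exact: outer_boundD.
Qed.

Lemma outer_bound_weaken chi s s' : s <= s' -> outer_bound chi s -> outer_bound chi s'.
Proof. by move=> ss h k km; rewrite (le_trans (h k km)). Qed.

(* Discrete Duhamel formula: when [P] kills [chi], [P W^k chi] equals
   [P (W^k - w^k) chi] with [w] the Euler step of the scalar [x], and [W - w]
   is [- i tau (H - x)]. *)
Lemma outer_bound_resolvent chi s x :
  normc (1 - 'i * (tau * x)%:C) <= c -> P *m chi = 0 ->
  outer_bound ((H - x%:C%:M) *m chi) s ->
  outer_bound chi (m%:R * tau * c ^+ m * s).
Proof.
move=> wc Pchi h k km; set w := 1 - _ in wc.
have c0 : 0 <= c by apply: le_trans c_ge1.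
have s0 : 0 <= s by apply: le_trans (h 0%N (leq0n _)); exact: nrm_ge0.
have cwW : GRing.comm W w%:M by exact: scalar_mxC.
have dW : W - w%:M = (- ('i * tau%:C)) *: (H - x%:C%:M).
  apply/matrixP => i j; rewrite /W /w !mxE rmorphM /=.
  by case: (i == j); rewrite ?mulr1n ?mulr0n; ring.
have -> : P *m (W ^+ k *m chi) =
    \sum_(i < k) (w ^+ i * - ('i * tau%:C)) *:
      (P *m (W ^+ (k.-1 - i) *m ((H - x%:C%:M) *m chi))).
  have -> : P *m (W ^+ k *m chi) = P *m ((W ^+ k - w%:M ^+ k) *m chi).
    by rewrite mulmxBl mulmxBr -rmorphXn /= mul_scalar_mx -scalemxAr Pchi scaler0 subr0.
  rewrite subrXX_comm // dW mulr_sumr mulmx_suml mulmx_sumr.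
  apply: eq_bigr => i _.
  rewrite -rmorphXn /= -scalerAl.
  have -> : (H - x%:C%:M) * (W ^+ (k.-1 - i) * (w ^+ i)%:M) =
      w ^+ i *: (W ^+ (k.-1 - i) * (H - x%:C%:M)).
    rewrite -!mulmxE [W ^+ _ *m _]scalar_mxC mul_scalar_mx -scalemxAr mulmxE.
    congr (_ *: _).
    apply: commrX; apply/commr_sym; apply: commrB; last exact: scalar_mxC.
    apply/commr_sym; apply: commrB; first exact: commr1.
    by rewrite /GRing.comm -scalerAl -scalerAr.
  by rewrite scalerA -!scalemxAl -scalemxAr mulrC !mulmxA.
apply: (le_trans (nrm_sum _ _)).
apply: (@le_trans _ _ (\sum_(i < k) (c ^+ m * tau * s))).
  apply: ler_sum => i _; rewrite nrmZ ler_pM ?nrm_ge0 ?normc_ge0 //; last first.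
    by apply: h; lia.
  rewrite ComplexField.Normc.normcM normcX normcN ComplexField.Normc.normcM.
  rewrite normc_real ger0_norm // ler_pM ?exprn_ge0 ?normc_ge0 ?mulr_ge0 ?normc_ge0 //.
    rewrite (@le_trans _ _ (c ^+ i)) //.
      by rewrite lerXn2r ?nnegrE ?normc_ge0.
    by rewrite ler_weXn2l //; have := ltn_ord i; lia.
  by rewrite /= expr0n expr1n add0r sqrtr1 mul1r.
rewrite sumr_const card_ord -[X in X <= _]mulr_natl.
have -> : m%:R * tau * c ^+ m * s = m%:R * (c ^+ m * tau * s) by ring.
rewrite ler_wpM2r ?ler_nat //.
by rewrite !mulr_ge0 // exprn_ge0.
Qed.

(** Comparison with a generator [H0] whose evolution of chi is never seen by P: in the Duhamel
    formula only the sources g k delta contribute, each then evolving under W. *)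
Lemma outer_bound_perturb (H0 : 'M[R[i]]_n.+1) (delta : 'cV[R[i]]_n.+1) (g : nat -> R[i]) chi s :
  (forall k, P *m (euler_step tau H0 ^+ k *m chi) = 0) ->
  (forall k, (H - H0) *m (euler_step tau H0 ^+ k *m chi) = g k *: delta) ->
  (forall k, (k <= m)%N -> normc (g k) <= s) ->
  outer_bound chi (m%:R * tau * c ^+ m * nrm delta * s).
Proof.
move=> P0 D gs k km; set W0 := euler_step tau H0 in P0 D.
have c0 : 0 <= c by apply: le_trans c_ge1.
have s0 : 0 <= s by apply: le_trans (gs 0%N (leq0n _)); exact: normc_ge0.
have dW : W - W0 = (- ('i * tau%:C)) *: (H - H0).
  by apply/matrixP => i j; rewrite /W /W0 !mxE; ring.
have -> : W ^+ k *m chi = W0 ^+ k *m chi +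
    \sum_(i < k) (- ('i * tau%:C) * g i) *: (W ^+ (k.-1 - i) *m delta).
  elim: k {km} => [|k IH]; first by rewrite big_ord0 addr0.
  rewrite exprS -mulmxA IH mulmxDr -{1}[W](subrK W0) dW mulmxDl -scalemxAl D.
  rewrite [in RHS]exprS -mulmxA big_ord_recr /= subnn expr0 mul1mx scalerA.
  rewrite [_ *: delta + _]addrC -addrA; congr (_ + _); rewrite addrC; congr (_ + _).
  rewrite mulmx_sumr; apply: eq_bigr => i _; rewrite -scalemxAr mulmxA mulmxE -exprS.
  by congr (_ *: (W ^+ _ *m _)); have := ltn_ord i; lia.
rewrite mulmxDr P0 add0r mulmx_sumr (le_trans (nrm_sum _ _)) //.
apply: (@le_trans _ _ (\sum_(i < k) (tau * s * (c ^+ m * nrm delta)))).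
  apply: ler_sum => i _; have ik := ltn_ord i.
  rewrite -scalemxAr nrmZ ler_pM ?nrm_ge0 ?normc_ge0 //; last first.
    by apply: outer_bound_nrm; lia.
  rewrite ComplexField.Normc.normcM normcN ComplexField.Normc.normcM.
  rewrite normc_real ger0_norm // ler_pM ?mulr_ge0 ?normc_ge0 //; last first.
    by apply: gs; lia.
  by rewrite /= expr0n expr1n add0r sqrtr1 mul1r.
rewrite sumr_const card_ord -[X in X <= _]mulr_natl.
have -> : m%:R * tau * c ^+ m * nrm delta * s = m%:R * (tau * s * (c ^+ m * nrm delta)).
  by ring.
rewrite ler_wpM2r ?ler_nat //.
by rewrite !mulr_ge0 ?exprn_ge0 ?nrm_ge0.
Qed.

(** * Replacing the roots of a polynomial one at a time *)

Section Telescope.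
Variables (q : nat) (e e' : nat -> R) (b s d : R) (chi : 'cV[R[i]]_n.+1).
Hypothesis ee' : forall j, (j < q)%N -> `|e j - e' j| <= b.
Hypothesis e_c : forall j, (j < q)%N -> normc (1 - 'i * (tau * e j)%:C) <= c.
Hypothesis Pchi : forall p : {poly R[i]}, (size p <= q)%N -> P *m (horner_mx H p *m chi) = 0.

(** The first j roots are moved from e to e', so [mixed] runs from the product over e at j = 0 to
    the product over e' at j = q; [mixed' j] is the common cofactor of [mixed j] and
    [mixed j.+1]. *)
Let mixed j : {poly R[i]} :=
  \prod_(i < q) ('X - (if (i < j)%N then e' i else e i)%:C%:P).
Let mixed' j : {poly R[i]} :=
  \prod_(i < q | i != j :> nat) ('X - (if (i < j)%N then e' i else e i)%:C%:P).

Lemma mixedE j : (j < q)%N -> mixed j = ('X - (e j)%:C%:P) * mixed' j.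
Proof. by move=> jq; rewrite /mixed (bigD1 (Ordinal jq)) //= ltnn. Qed.

Lemma mixedSE j : (j < q)%N -> mixed j.+1 = ('X - (e' j)%:C%:P) * mixed' j.
Proof.
move=> jq; rewrite [LHS](bigD1 (Ordinal jq)) //= ltnSn; congr (_ * _).
by apply: eq_bigr => i ij; rewrite ltnS leq_eqVlt [_ == j](negPf ij).
Qed.

Lemma size_mixed' j : (j < q)%N -> (size (mixed' j) <= q)%N.
Proof.
move=> jq; have sz : size (mixed j) = q.+1.
  by rewrite /mixed size_prod_XsubC -[index_enum _]enumT size_enum_ord.
have mon : mixed' j \is monic by exact: monic_prod_XsubC.
move: sz; rewrite mixedE // size_monicM ?monicXsubC ?monic_neq0 // size_XsubC /=.
by move=> [] <-.
Qed.

(** Cost of moving one root: its displacement times the Duhamel factor of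
    [outer_bound_resolvent]. *)
Let r := b * (m%:R * tau * c ^+ m).

(** As the two products differ by the constant d, chi is 1/d times the telescoping sum of the
    differences of [mixed], applied to chi. Each difference contributes r times the bound for
    [mixed j], and each root already moved raises that bound by a factor at most 1 + r. *)
Lemma outer_bound_telescope :
  outer_bound (horner_mx H (\prod_(j < q) ('X - (e j)%:C%:P)) *m chi) s ->
  \prod_(j < q) ('X - (e' j)%:C%:P) - \prod_(j < q) ('X - (e j)%:C%:P) = d%:C%:P ->
  0 < d ->
  outer_bound chi (q%:R * r * (1 + r) ^+ q * s / d).
Proof.
have c0 : 0 <= c by apply: le_trans c_ge1.
move=> h0 eqd d0.
have s0 : 0 <= s by apply: le_trans (h0 0%N (leq0n _)); exact: nrm_ge0.
(* The cofactor has degree below q, so P kills it on chi and the factor H - e j can be traded for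
   the Duhamel factor. *)
have step j s' : (j < q)%N -> outer_bound (horner_mx H (mixed j) *m chi) s' ->
    outer_bound (horner_mx H (mixed' j) *m chi) (m%:R * tau * c ^+ m * s').
  move=> jq h; apply: (outer_bound_resolvent (e_c jq)).
    by apply: Pchi; exact: size_mixed'.
  by move: h; rewrite (mixedE jq) horner_mx_XsubCM -mulmxA.
have diff j : (j < q)%N -> mixed j.+1 - mixed j = (e j - e' j)%:C *: mixed' j.
  move=> jq; rewrite (mixedE jq) (mixedSE jq) -mulrBl -mul_polyC; congr (_ * _).
  by rewrite rmorphB polyCB; ring.
have b_ge0 j : (j < q)%N -> 0 <= b.
  by move=> jq; apply: le_trans (ee' jq); exact: normr_ge0.
have r_ge0 j : (j < q)%N -> 0 <= r.
  by move=> jq; rewrite !mulr_ge0 ?exprn_ge0 //; apply: b_ge0 jq.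
have term j s' : (j < q)%N -> 0 <= s' -> outer_bound (horner_mx H (mixed j) *m chi) s' ->
    outer_bound (horner_mx H (mixed j.+1 - mixed j) *m chi) (r * s').
  move=> jq s'0 h; rewrite diff // linearZ /= -scalemxAl.
  apply: outer_bound_weaken (outer_boundZ _ (step _ _ jq h)).
  rewrite normc_real /r -[in X in _ <= X]mulrA ler_wpM2r ?ee' //.
  by rewrite !mulr_ge0 ?exprn_ge0.
have mixed_bound j : (j <= q)%N ->
    outer_bound (horner_mx H (mixed j) *m chi) ((1 + r) ^+ j * s).
  elim: j => [|j IH] jq; first by rewrite expr0 mul1r.
  have r0 := r_ge0 _ jq.
  have := outer_boundD (IH (ltnW jq)) (term j _ jq _ (IH (ltnW jq))).
  rewrite -mulmxDl -rmorphD /= subrKC => h.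
  apply: outer_bound_weaken (h _); last by rewrite mulr_ge0 ?exprn_ge0 ?addr_ge0.
  by rewrite exprS -mulrA mulrDl mul1r.
have -> : chi = (d%:C)^-1 *: (horner_mx H (\sum_(j < q) (mixed j.+1 - mixed j)) *m chi).
  have -> : \sum_(j < q) (mixed j.+1 - mixed j) = d%:C%:P.
    rewrite -(big_mkord xpredT (fun j => mixed j.+1 - mixed j)) telescope_sumr //.
    by rewrite -eqd; congr (_ - _); apply: eq_bigr => j _; rewrite ltn_ord.
  rewrite horner_mx_C mul_scalar_mx scalerA mulVf ?scale1r //.
  by rewrite fmorph_eq0 gt_eqF.
rewrite -fmorphV /= mulrC; apply: outer_bound_weaken (outer_boundZ _ _); last first.
  rewrite raddf_sum /= mulmx_suml; apply: (@outer_bound_sum _ _ _ (fun=> r * ((1 + r) ^+ q * s))).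
  move=> j; have jq := ltn_ord j; have r0 := r_ge0 _ jq.
  apply: outer_bound_weaken (term j _ jq _ (mixed_bound j (ltnW jq))).
    rewrite ler_wpM2l // ler_wpM2r // ler_weXn2l ?lerDl //; exact: ltnW.
  by rewrite mulr_ge0 ?exprn_ge0 ?addr_ge0.
rewrite sumr_const card_ord normc_real ger0_norm ?invr_ge0 ?(ltW d0) //.
by rewrite -[X in _ * X <= _]mulr_natl !mulrA.
Qed.

End Telescope.
End Duhamel.

(** * Finite Jacobi matrices *)

Section Jacobi.
Local Open Scope complex_scope.
Variables (R : rcfType) (v : nat -> R) (N : nat).
Implicit Types (u : 'cV[R[i]]_N.+1) (k r : nat).

(** The restriction to the sites below r is padded by zeros, so that all truncations act on the same
    space and can be subtracted. *)
Definition jacobi_real r : 'M[R]_N.+1 := \matrix_(i, j)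
  if (i < r)%N && (j < r)%N then
    (if i == j then v i else 0)
    + (if (j == i.+1 :> nat) || (i == j.+1 :> nat) then 1 else 0)
  else 0.

Definition jacobi r : 'M[R[i]]_N.+1 := map_mx (real_complex R) (jacobi_real r).

(** Indexed by nat to ease index arithmetic; it is the zero vector when k > N. *)
Definition site k : 'cV[R[i]]_N.+1 := \col_i (i == k :> nat)%:R.

Definition supported u k := forall i : 'I_N.+1, (k < i)%N -> u i 0 = 0.

Lemma jacobi_realT r : (jacobi_real r)^T = jacobi_real r.
Proof.
apply/matrixP => i j; rewrite !mxE andbC; case: ifP => // _.
by rewrite orbC; congr (_ + _); rewrite (eq_sym j); case: eqP => [->|].
Qed.

Lemma jacobi_row_sum M r i : (forall n, `|v n| <= M) ->
  \sum_j `|jacobi_real r i j| <= M + 2.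
Proof.
move=> vM; have M0 : 0 <= M by apply: le_trans (vM 0%N); exact: normr_ge0.
pose f (b : bool) (x : R) := if b then x else 0.
apply: (@le_trans _ _ (\sum_(j < N.+1)
   (f (j == i :> nat) M + f (j == i.+1 :> nat) 1 + f (j == i.-1 :> nat) 1))).
  apply: ler_sum => j _; rewrite mxE.
  have f0 b x : 0 <= x -> 0 <= f b x by rewrite /f; case: b.
  case: ifP => _; last by rewrite normr0 !addr_ge0 // f0.
  rewrite (le_trans (ler_normD _ _)) // -addrA lerD //.
    by rewrite /f eq_sym -val_eqE; case: eqP => _; rewrite ?normr0.
  case: ifP => [|_]; last by rewrite normr0 addr_ge0 // f0.
  rewrite normr1 => /orP[/eqP->|/eqP->]; rewrite /f eqxx.
    by rewrite lerDl; case: ifP.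
  by rewrite lerDr; case: ifP.
rewrite !big_split /= /f.
rewrite (sum_delta_ord _ _ (fun=> M)) (sum_delta_ord _ _ (fun=> 1)).
rewrite (sum_delta_ord _ _ (fun=> 1)) ltn_ord -addrA lerD //.
have -> : 2 = 1 + 1 :> R by [].
by apply: lerD; case: ifP.
Qed.

Lemma siteE k (i : 'I_N.+1) : site k i 0 = (i == k :> nat)%:R.
Proof. by rewrite mxE. Qed.

Lemma nrm_site k : nrm (site k) <= 1.
Proof.
rewrite -[leRHS]sqrtr1 ler_wsqrtr //.
rewrite (eq_bigr (fun i : 'I_N.+1 => if i == k :> nat then 1 else 0 : R)).
  by rewrite (sum_delta_ord _ _ (fun=> 1)); case: ifP.
move=> i _; rewrite siteE; case: eqP => _.
  by rewrite mulr1n ComplexField.Normc.normc1 expr1n.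
by rewrite mulr0n ComplexField.Normc.normc0 expr0n.
Qed.

Lemma mulmx_siteE (A : 'M[R[i]]_N.+1) (k i : 'I_N.+1) : (A *m site k) i 0 = A i k.
Proof.
rewrite mxE (bigD1 k) //= siteE eqxx mulr1 big1 ?addr0 // => j jk.
by rewrite siteE [_ == _](negPf jk) mulr0.
Qed.

Lemma jacobi_site r k : (k < r <= N.+1)%N ->
  jacobi r *m site k = (if (k.+1 < r)%N then site k.+1 else 0) +
    (if (0 < k)%N then site k.-1 else 0) + (v k)%:C *: site k.
Proof.
move=> /andP[kr rN]; apply/colP => i.
have kN : (k < N.+1)%N by exact: leq_trans rN.
rewrite -[k in LHS]/(nat_of_ord (Ordinal kN)) mulmx_siteE !mxE /= kr andbT.
have -> (b : bool) (x : 'cV[R[i]]_N.+1) : (if b then x else 0) i 0 = if b then x i 0 else 0.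
  by case: b; rewrite ?mxE.
have -> (b : bool) (x : 'cV[R[i]]_N.+1) : (if b then x else 0) i 0 = if b then x i 0 else 0.
  by case: b; rewrite ?mxE.
rewrite !siteE (_ : (i == Ordinal kN) = (i == k :> nat)) //.
have [ir|ri] := ltnP i r; last first.
  have -> : (i == k :> nat) = false by lia.
  have -> : (i == k.-1 :> nat) = false by lia.
  case: ifP => h; rewrite ?if_same ?mulr0 ?addr0 ?rmorph0 //.
  by have -> : (i == k.+1 :> nat) = false by lia.
rewrite rmorphD /= [RHS]addrC; congr (_ + _).
  by case: eqP => [->|_]; rewrite ?mulr1 ?mulr0 ?rmorph0.
have [e|ik] := eqVneq (nat_of_ord i) k.+1.
  rewrite -e ir orbT (_ : (i == k.-1 :> nat) = false); last by lia.
  by rewrite if_same addr0 rmorph1.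
rewrite if_same add0r orbF.
have [e|ki] := eqVneq k i.+1; first by rewrite e eqxx rmorph1.
by case: ltnP => k0; rewrite ?rmorph0 // (_ : (i == k.-1 :> nat) = false) //; lia.
Qed.

Lemma supported_jacobi r k u : supported u k -> supported (jacobi r *m u) k.+1.
Proof.
move=> uk i ki; rewrite mxE big1 // => j _.
have [jk|kj] := leqP j k; last by rewrite uk ?mulr0.
rewrite !mxE -val_eqE /= (_ : (i == j :> nat) = false); last by lia.
rewrite (_ : (j == i.+1 :> nat) = false); last by lia.
rewrite (_ : (i == j.+1 :> nat) = false); last by lia.
by rewrite addr0 if_same rmorph0 mul0r.
Qed.

Lemma jacobi_supported r u : supported (jacobi r.+1 *m u) r.
Proof.
move=> i ri; rewrite mxE big1 // => j _.
by rewrite !mxE ltnS leqNgt ri rmorph0 mul0r.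
Qed.

Lemma jacobi_restrict r k u : supported u k -> (k.+1 < r)%N ->
  jacobi r *m u = jacobi N.+1 *m u.
Proof.
move=> uk kr; apply/colP => i; rewrite !mxE; apply: eq_bigr => j _.
have [jk|kj] := leqP j k; last by rewrite uk ?mulr0.
rewrite !mxE !ltn_ord /= (_ : (j < r)%N); last by lia.
have [//|ri] := ltnP i r.
rewrite /= -val_eqE /= (_ : (i == j :> nat) = false); last by lia.
rewrite (_ : (j == i.+1 :> nat) = false); last by lia.
by rewrite (_ : (i == j.+1 :> nat) = false) ?addr0 //; lia.
Qed.

(** On vectors supported up to site r, the truncation is felt only through the bond between r and r
    + 1. *)
Lemma jacobi_cut r u : supported u r -> (r < N)%N ->
  (jacobi N.+1 - jacobi r.+1) *m u = u (inord r) 0 *: site r.+1.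
Proof.
move=> ur rN; apply/colP => i; rewrite [LHS]mxE [RHS]mxE siteE.
have rv : (inord r : 'I_N.+1) = r :> nat by rewrite (@inordK N) // ltnS ltnW.
rewrite (bigD1 (inord r)) //= big1 => [|j jr].
  rewrite addr0 mulrC; congr (_ * _); rewrite !mxE !ltn_ord -val_eqE /= rv ltnSn andbT.
  have [ir|ri] := ltnP i r.+1; first by rewrite subrr (ltn_eqF ir).
  rewrite rmorph0 subr0 (_ : (i == r :> nat) = false); last by lia.
  rewrite (_ : (r == i.+1 :> nat) = false) ?add0r; last by lia.
  by case: eqP; rewrite ?rmorph1 ?rmorph0.
have {}jr : j != r :> nat by apply: contra jr => /eqP e; rewrite -val_eqE /= e rv.
have [jk|kj] := leqP j r; last by rewrite ur ?mulr0.
rewrite !mxE !ltn_ord (_ : (j < r.+1)%N) // andbT /=.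
have [ir|ri] := ltnP i r.+1; first by rewrite subrr mul0r.
rewrite -val_eqE /= (_ : (i == j :> nat) = false); last by lia.
rewrite (_ : (j == i.+1 :> nat) = false); last by lia.
rewrite (_ : (i == j.+1 :> nat) = false); last by lia.
by rewrite addr0 subrr mul0r.
Qed.

Lemma supported_site k : supported (site k) k.
Proof. by move=> i ki; rewrite siteE gtn_eqF. Qed.

Lemma horner_mx_sum (H : 'M[R[i]]_N.+1) (p : {poly R[i]}) u :
  horner_mx H p *m u = \sum_(k < size p) p`_k *: (H ^+ k *m u).
Proof.
rewrite -{1}[p]coefK poly_def raddf_sum mulmx_suml; apply: eq_bigr => k _ /=.
by rewrite linearZ /= rmorphXn /= horner_mx_X -scalemxAl.
Qed.

Lemma supported_jacobi_iter r k : supported (jacobi r ^+ k *m site 0) k.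
Proof.
elim: k => [|k IH]; first by rewrite expr0 mul1mx; exact: supported_site.
by rewrite exprS -mulmxA; exact: supported_jacobi.
Qed.

Lemma supported_horner_jacobi r (p : {poly R[i]}) k : (size p <= k.+1)%N ->
  supported (horner_mx (jacobi r) p *m site 0) k.
Proof.
move=> pk i ki; rewrite horner_mx_sum summxE big1 // => j _.
rewrite mxE (@supported_jacobi_iter r j) ?mulr0 //.
by have := ltn_ord j; lia.
Qed.

(** Each power of H moves the support by one site, so powers below r started at site 0 never cross
    the cut. *)
Lemma horner_jacobi_restrict r (p : {poly R[i]}) : (size p <= r)%N ->
  horner_mx (jacobi r) p *m site 0 = horner_mx (jacobi N.+1) p *m site 0.
Proof.
move=> pr; rewrite [LHS]horner_mx_sum [RHS]horner_mx_sum; apply: eq_bigr => k _; congr (_ *: _).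
have : (k < r)%N by have := ltn_ord k; lia.
elim: (nat_of_ord k) => [|l IH] lr; first by rewrite !expr0.
rewrite !exprS -[LHS]mulmxA -[RHS]mulmxA (IH (ltnW lr)).
exact: jacobi_restrict (@supported_jacobi_iter N.+1 l) lr.
Qed.

Lemma horner_mx_tr (H : 'M[R[i]]_N.+1) (p : {poly R[i]}) : H^T = H ->
  (horner_mx H p)^T = horner_mx H p.
Proof.
move=> HT; elim/poly_ind: p => [|p c IH]; first by rewrite rmorph0 trmx0.
rewrite rmorphD rmorphM /= horner_mx_X horner_mx_C linearD /= trmx_mul IH HT.
rewrite tr_scalar_mx; congr (_ + _); rewrite -mulmxE.
transitivity (horner_mx H ('X * p)); first by rewrite rmorphM /= horner_mx_X.
by rewrite mulrC rmorphM /= horner_mx_X.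
Qed.

Let w n : R[i] := (v n)%:C.

(** The continuants are the orthogonal polynomials of the Jacobi matrix: their recursion is the
    equation for H applied to [site k], solved for [site k.+1]. *)
Lemma continuant_site k : (k <= N)%N ->
  horner_mx (jacobi N.+1) (continuant w k) *m site 0 = site k.
Proof.
elim/ltn_ind: k => -[|[|k]] IH kN.
- by rewrite continuant0 rmorph1 mul1mx.
- rewrite continuant1 rmorphB /= horner_mx_X horner_mx_C mulmxBl mul_scalar_mx.
  by rewrite jacobi_site ?leqnn // [(1 < N.+1)%N]kN addr0 addrK.
rewrite continuantSS rmorphB /= horner_mx_XsubCM mulmxBl.
rewrite -mulmxA !IH //; try lia.
rewrite mulmxBl mul_scalar_mx jacobi_site; last by lia.
by rewrite ltnS kN /= addrK addrK.
Qed.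

(** Mirror image of [continuant_site]: the chain cut after site r is read from its right end, using
    the potential of its last j sites. [continuant_shift] supplies the recursion in this
    direction. *)
Lemma continuant_site_rev r j : (j <= r <= N)%N ->
  horner_mx (jacobi r.+1) (continuant (fun k => w (r.+1 - j + k)) j) *m site r =
  site (r - j).
Proof.
elim/ltn_ind: j => -[|[|j]] IH /andP[jr rN].
- by rewrite continuant0 rmorph1 mul1mx subn0.
- rewrite continuant1 rmorphB /= horner_mx_X horner_mx_C mulmxBl mul_scalar_mx.
  rewrite jacobi_site ?ltnSn // ltnn add0r jr (_ : r.+1 - 1 + 0 = r)%N; last by lia.
  by rewrite addrK subn1.
rewrite continuant_shift rmorphB /= horner_mx_XsubCM mulmxBl.
rewrite (@eq_continuant _ _ (fun k => w (r.+1 - j.+1 + k))); last first.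
  by move=> k kj /=; congr w; lia.
rewrite (@eq_continuant _ (_ \o _ \o _) (fun k => w (r.+1 - j + k))); last first.
  by move=> k kj /=; congr w; lia.
rewrite -mulmxA !IH //; try lia.
rewrite mulmxBl mul_scalar_mx jacobi_site; last by lia.
rewrite (_ : (r - j.+1).+1 = r - j)%N; last by lia.
rewrite (_ : (r - j < r.+1)%N); last by lia.
rewrite (_ : (0 < r - j.+1)%N); last by lia.
rewrite (_ : (r - j.+1).-1 = r - j.+2)%N; last by lia.
rewrite (_ : r.+1 - j.+2 + 0 = r - j.+1)%N; last by lia.
by rewrite addrK [site _ + _]addrC addrK.
Qed.
End Jacobi.

(** * Leakage out of the first period on a finite box *)

Section OuterJacobi.
Local Open Scope complex_scope.
Variables (R : rcfType) (v : nat -> R) (N : nat).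
Implicit Types (u : 'cV[R[i]]_N.+1).
Let w n : R[i] := (v n)%:C.

Definition outer q : 'M[R[i]]_N.+1 :=
  \matrix_(i, j) if (i == j) && (q <= i)%N then 1 else 0.

Lemma outerE q u i : (outer q *m u) i 0 = if (q <= i)%N then u i 0 else 0.
Proof.
rewrite mxE (bigD1 i) //= mxE eqxx /= big1 ?addr0 => [|j ji].
  by case: ifP => _; rewrite ?mul1r ?mul0r.
by rewrite mxE eq_sym (negPf ji) mul0r.
Qed.

Lemma nrm_outer q u : nrm (outer q *m u) <= nrm u.
Proof.
apply: ler_wsqrtr; apply: ler_sum => i _; rewrite outerE; case: ifP => // _.
by rewrite ComplexField.Normc.normc0 expr0n sqr_ge0.
Qed.

Lemma outer_supported q k u : supported u k -> (k < q)%N -> outer q *m u = 0.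
Proof.
move=> uk kq; apply/colP => i; rewrite outerE [RHS]mxE; case: ifP => // qi.
by rewrite uk // (leq_trans kq).
Qed.

Variables (M K c tau b : R) (m n : nat) (e e' : nat -> R).
Hypothesis vM : forall k, `|v k| <= M.
Hypothesis MK : M + 2 <= K.
Hypothesis eK : forall j, (j < n.+2)%N -> `|e j| <= K.
Hypothesis tau_ge0 : 0 <= tau.
Hypothesis c_ge1 : 1 <= c.
Hypothesis cK : 1 + (tau * K) ^+ 2 <= c ^+ 2.
Hypothesis nN : (n.+2 <= N)%N.
Hypothesis prod_e : \prod_(j < n.+2) ('X - (e j)%:C%:P) =
  continuant w n.+2 - continuant (w \o succn) n - 2%:P.
Hypothesis prod_e' : \prod_(j < n.+2) ('X - (e' j)%:C%:P) =
  continuant w n.+2 - continuant (w \o succn) n + 2%:P.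
Hypothesis ee' : forall j, (j < n.+2)%N -> `|e j - e' j| <= b.

Let c_ge0 : 0 <= c. Proof. exact: le_trans c_ge1. Qed.

Lemma euler_scalar_le x : `|x| <= K -> normc (1 - 'i * (tau * x)%:C) <= c.
Proof.
move=> xK; rewrite -(ler_pXn2r (n := 2)) ?nnegrE ?normc_ge0 // normc_sqr.
apply: le_trans cK.
have -> : complex.Re (1 - 'i * (tau * x)%:C) = 1 by rewrite /=; ring.
have -> : complex.Im (1 - 'i * (tau * x)%:C) = - (tau * x) by rewrite /=; ring.
rewrite expr1n lerD2l sqrrN -[leLHS]real_normK ?num_real //.
rewrite lerXn2r ?nnegrE ?mulr_ge0 ?(le_trans _ xK) //.
by rewrite normrM (ger0_norm tau_ge0) ler_wpM2l.
Qed.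

Lemma nrm_euler_jacobi r u : nrm (euler_step tau (jacobi v N r) *m u) <= c * nrm u.
Proof.
apply: (le_trans (nrm_euler_step _ _ (jacobi_realT v N r)
   (fun i => jacobi_row_sum r i vM))).
rewrite ler_wpM2r ?nrm_ge0 // -[leRHS]ger0_norm // -sqrtr_sqr ler_wsqrtr //.
apply: le_trans cK; rewrite lerD2l.
have M0 : 0 <= M by apply: le_trans (vM 0%N); exact: normr_ge0.
have K0 : 0 <= K by apply: le_trans MK; rewrite addr_ge0.
by rewrite lerXn2r ?nnegrE ?mulr_ge0 ?addr_ge0 // ler_wpM2l.
Qed.

Let H := jacobi v N N.+1.
Let H0 := jacobi v N n.+1.
Let P := outer n.+2.
Let L := c ^+ m.

(* The vector is also [s(H0) delta_0] with [H0] the restriction to the sites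
   0, ..., n, and leaks from there only through the site n; since [H0] is
   symmetric and [s(H0) delta_n = delta_0], its component at n under the Euler
   scheme of [H0] is the (0, 0) entry of that scheme. *)
Lemma outer_bound_continuant :
  outer_bound P H tau m (horner_mx H (continuant (w \o succn) n) *m site R N 0)
   (m%:R * tau * L * L).
Proof.
have e0 : horner_mx H (continuant (w \o succn) n) *m site R N 0 =
    horner_mx H0 (continuant (w \o succn) n) *m site R N 0.
  by apply/esym/horner_jacobi_restrict; rewrite size_continuant.
rewrite e0.
set chi := _ *m _; pose W0 := euler_step tau H0.
have chi_supp k : supported (W0 ^+ k *m chi) n.
  elim: k => [|k IH].
    by rewrite expr0 mul1mx; apply: supported_horner_jacobi; rewrite size_continuant.
  move=> i ni; rewrite exprS -mulmxA mulmxBl mul1mx -scalemxAl.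
  set u := W0 ^+ k *m chi in IH *.
  by rewrite [LHS]mxE (IH i ni) add0r mxE [X in - X]mxE jacobi_supported // mulr0 oppr0.
apply: (@outer_bound_weaken _ _ _ _ _ _ _ (m%:R * tau * L * nrm (site R N n.+1) * L)).
  have L0 : 0 <= L by exact: exprn_ge0.
  by rewrite ler_wpM2r // -[leRHS]mulr1 ler_wpM2l ?nrm_site // !mulr_ge0.
apply: (outer_bound_perturb tau_ge0 c_ge1 (@nrm_outer _) (@nrm_euler_jacobi N.+1)
   (H0 := H0) (g := fun k => (W0 ^+ k *m chi) (inord n) 0)).
- by move=> k; apply: outer_supported (chi_supp k) _.
- by move=> k; apply: jacobi_cut (chi_supp k) _; exact: ltnW.
move=> k km.
have H0T : H0^T = H0 by rewrite /H0 /jacobi map_trmx jacobi_realT.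
pose W0p : {poly R[i]} := 1 - ('i * tau%:C) *: 'X.
have W0E : W0 = horner_mx H0 W0p.
  by rewrite /W0 /W0p -mul_polyC rmorphB rmorph1 rmorphM /=
    horner_mx_C horner_mx_X -mulmxE mul_scalar_mx.
pose Z := horner_mx H0 (W0p ^+ k * continuant (w \o succn) n).
have inordn : (inord n : 'I_N.+1) = n :> nat by rewrite inordK //; lia.
have -> : (W0 ^+ k *m chi) (inord n) 0 = (W0 ^+ k *m site R N 0) 0 0.
  transitivity ((Z *m site R N 0) (inord n) 0).
    by rewrite /Z rmorphM rmorphXn /= -W0E -mulmxA.
  rewrite -[0%N]/(nat_of_ord (ord0 : 'I_N.+1)) mulmx_siteE.
  rewrite -[Z](horner_mx_tr _ H0T) mxE -mulmx_siteE inordn.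
  rewrite /Z rmorphM rmorphXn /= -W0E -mulmxA; congr ((_ *m _) _ _).
  have := @continuant_site_rev R v N n n; rewrite leqnn subnn => <- //; last by lia.
  congr (horner_mx _ _ *m _); apply: eq_continuant => l _ /=.
  by rewrite /w subSnn add1n.
apply: (le_trans (normc_le_nrm _ _)).
apply: (le_trans (nrm_euler_iter c_ge1 (@nrm_euler_jacobi n.+1) _ km)).
by rewrite -[leRHS]mulr1 ler_wpM2l ?exprn_ge0 // nrm_site.
Qed.

Let r := b * (m%:R * tau * L).

(** Telescoping with d = 4. Applied to site 0, the product over e gives site n + 2, minus the
    continuant vector, minus twice site 0; the three pieces contribute at most L, m tau L L and 2
    L. *)
Lemma nrm_outer_euler :
  nrm (P *m (euler_step tau H ^+ m *m site R N 0)) <=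
  n.+2%:R * r * (1 + r) ^+ n.+2 * (3 * L + m%:R * tau * L * L) / 4.
Proof.
have nW := @nrm_euler_jacobi N.+1.
have := @outer_bound_telescope _ _ P H tau c m tau_ge0 c_ge1
  n.+2 e e' b (3 * L + m%:R * tau * L * L) 4 (site R N 0) ee'; apply => //.
- by move=> j jn; apply/euler_scalar_le/eK.
- move=> p pn; apply: outer_supported (_ : supported _ n.+1) _ => //.
  exact: supported_horner_jacobi.
- rewrite prod_e; have := outer_bound_continuant; have := continuant_site v nN.
  rewrite -/w; move: (continuant w n.+2) (continuant _ n) => p1 p2 e1 ob2.
  rewrite !rmorphB /= horner_mx_C !mulmxBl mul_scalar_mx e1.
  have le3 : L * nrm (site R N n.+2) + m%:R * tau * L * L + 2 * L <=
      3 * L + m%:R * tau * L * L.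
    have L0 : 0 <= L by exact: exprn_ge0.
    by have := ler_wpM2l L0 (nrm_site R N n.+2); lra.
  apply: outer_bound_weaken le3 _.
  apply: outer_boundD; first apply: outer_boundD.
  + exact: (outer_bound_nrm c_ge1 (@nrm_outer _) nW).
  + have := outer_boundZ (-1) ob2.
    by rewrite normcN ComplexField.Normc.normc1 mul1r scaleN1r.
  + rewrite -scaleNr.
    have := outer_boundZ (- 2) (outer_bound_nrm c_ge1 (@nrm_outer n.+2) nW (site R N 0)).
    have -> : normc (- 2 : R[i]) = 2.
      by rewrite normcN -(rmorph_nat (real_complex R)) normc_real ger0_norm.
    move=> /(_ m) ob; apply: outer_bound_weaken ob.
    by rewrite ler_wpM2l // -[leRHS]mulr1 ler_wpM2l ?exprn_ge0 // nrm_site.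
rewrite prod_e prod_e' opprD opprK addrACA subrr add0r -polyCD.
by congr (_%:P); rewrite -natrD -[RHS]/(real_complex R _) rmorph_nat.
Qed.

End OuterJacobi.

(** * Convergence of the Euler scheme *)

Section ExponentialSeries.
Local Open Scope classical_set_scope.
Local Open Scope ring_scope.
Local Open Scope complex_scope.
Variable R : realType.
Implicit Types (x y t : R).

Lemma sum_exp_coeff_le x N : 0 <= x -> \sum_(k < N) exp_coeff x k <= expR x.
Proof.
move=> x0; rewrite -(big_mkord xpredT (exp_coeff x)) -[leLHS]/(series (exp_coeff x) N).
apply: nondecreasing_cvgn_le; last exact: is_cvg_series_exp_coeff.
by apply: nondecreasing_series => n _ _; exact: exp_coeff_ge0.
Qed.

(** Since x^k = y^k (x/y)^k and y^k <= y^N for k >= N. The parameter y trades the decay rate in N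
    against the size of the constant. *)
Lemma tail_exp_coeff_le x y N n : 0 <= x -> 0 < y <= 1 ->
  \sum_(N <= k < n) exp_coeff x k <= y ^+ N * expR (x / y).
Proof.
move=> x0 /andP[y0 y1].
have xy0 : 0 <= x / y by rewrite divr_ge0 // ltW.
apply: (@le_trans _ _ (\sum_(N <= k < n) y ^+ N * exp_coeff (x / y) k)).
  rewrite big_nat_cond [leRHS]big_nat_cond.
  apply: ler_sum => k /andP[/andP[Nk _] _].
  have -> : exp_coeff x k = y ^+ k * exp_coeff (x / y) k.
    by rewrite /exp_coeff /= mulrA -exprMn [y * _]mulrC divfK ?gt_eqF.
  by rewrite ler_wpM2r ?exp_coeff_ge0 // ler_wiXn2l // ltW.
rewrite -mulr_sumr ler_wpM2l ?exprn_ge0 ?(ltW y0) //.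
apply: le_trans (sum_exp_coeff_le n xy0).
rewrite -(big_mkord xpredT (exp_coeff (x / y))).
have [Nn|nN] := leqP N n; last first.
  by rewrite (big_geq (ltnW nN)); apply: sumr_ge0 => k _; exact: exp_coeff_ge0.
rewrite [leRHS](big_cat_nat (n := N)) //= lerDr.
by apply: sumr_ge0 => k _; exact: exp_coeff_ge0.
Qed.

Lemma series_exp_coeff_cvg x (u : R ^nat) : (forall k, `|u k| <= exp_coeff x k) -> 0 <= x ->
  cvgn (series u) /\
  (forall y N, 0 < y <= 1 ->
     `|limn (series u) - \sum_(k < N) u k| <= y ^+ N * expR (x / y)).
Proof.
move=> ux x0.
have cu : cvgn (series u).
  apply: normed_cvg.
  apply: (@series_le_cvg _ _ (exp_coeff x)) => [n|n|n|].
  - exact: normr_ge0.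
  - exact: exp_coeff_ge0.
  - exact: ux.
  - exact: is_cvg_series_exp_coeff.
split=> // y N y01.
rewrite -(big_mkord xpredT u).
have cN : (fun n => `|series u n - \sum_(0 <= k < N) u k|) @ \oo -->
    `|limn (series u) - \sum_(0 <= k < N) u k|.
  by apply: cvg_norm; apply: cvgB => //; exact: cvg_cst.
rewrite -(cvg_lim _ cN) //; apply: limr_le; first by apply/cvg_ex; eexists; exact: cN.
near=> n; have Nn : (N <= n)%N by near: n; exact: nbhs_infty_ge.
rewrite /series /= (big_cat_nat (n := N)) //= addrC addrK.
apply: (le_trans (ler_norm_sum _ _ _)).
apply: le_trans (tail_exp_coeff_le N n x0 y01).
by apply: ler_sum => k _.
Unshelve. all: by end_near. Qed.

(* [1 + x/m >= e^(x/m) (1 - (x/m)^2)], followed by Bernoulli's inequality. *)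
Lemma expR_sub_euler_le x m : (0 < m)%N -> x <= m%:R -> 0 <= x ->
  expR x - (1 + x / m%:R) ^+ m <= expR x * x ^+ 2 / m%:R.
Proof.
move=> m0 xm x0; have mR : 0 < m%:R :> R by rewrite ltr0n.
set y := x / m%:R; have y0 : 0 <= y by rewrite divr_ge0 // ltW.
have y1 : y <= 1 by rewrite ler_pdivrMr // mul1r.
have eM : expR x = expR y ^+ m by rewrite -expRM_natl /y mulrC divfK // gt_eqF.
have bern k : 1 - k%:R * y ^+ 2 <= (1 - y ^+ 2) ^+ k.
  have yy : 0 <= 1 - y ^+ 2 by rewrite subr_ge0 expr_le1.
  elim: k => [|k IH]; first by rewrite mul0r subr0 expr0.
  rewrite [leRHS]exprS; apply: (le_trans _ (ler_wpM2l yy IH)).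
  have : 0 <= k%:R * y ^+ 2 * y ^+ 2 by rewrite !mulr_ge0 ?sqr_ge0.
  by rewrite -natr1; lra.
have key : expR y * (1 - y ^+ 2) <= 1 + y.
  have e1 : 1 - y <= expR (- y) by have := expR_ge1Dx (- y).
  have ey : 0 < expR y by exact: expR_gt0.
  have -> : expR y * (1 - y ^+ 2) = (expR y * (1 - y)) * (1 + y) by ring.
  have : expR y * (1 - y) <= 1.
    apply: (le_trans (ler_wpM2l (ltW ey) e1)).
    by rewrite expRN divff // gt_eqF.
  move=> h; rewrite -[leRHS]mul1r ler_wpM2r // addr_ge0 //.
rewrite lerBlDr -lerBlDl.
have -> : expR x - expR x * x ^+ 2 / m%:R = expR y ^+ m * (1 - m%:R * y ^+ 2).
  by rewrite -eM /y; field; rewrite gt_eqF.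
apply: (le_trans (ler_wpM2l _ (bern m))); first by rewrite exprn_ge0 // expR_ge0.
rewrite -exprMn lerXn2r ?nnegrE ?addr_ge0 // mulr_ge0 ?expR_ge0 //.
by rewrite subr_ge0 expr_le1.
Qed.

End ExponentialSeries.

(** * Iterates of the half-line operator on the first basis vector *)

Section Iterates.
Local Open Scope classical_set_scope.
Local Open Scope ring_scope.
Local Open Scope complex_scope.
Variables (R : realType) (V : nat -> R) (M : R).
Hypothesis VM : forall n, `|V n| <= M.

(** The matrix element <delta_n, H^k delta_0> of the half-line operator, without any box. *)
Definition moment k n : R[i] := iter k (schroedinger V) (delta R 0) n.

Lemma momentS k n : moment k.+1 n =
  moment k n.+1 + (if n is m.+1 then moment k m else 0) + (V n)%:C * moment k n.
Proof. by []. Qed.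

Lemma moment_gt k n : (k < n)%N -> moment k n = 0.
Proof.
elim: k n => [|k IH] [|n] // kn.
rewrite momentS /= (IH n.+2) ?(IH n) ?(IH n.+1); try lia.
by rewrite mulr0 !addr0.
Qed.

Lemma moment_diag n : moment n n = 1.
Proof.
elim: n => [|n IH]; first by rewrite /moment /= /delta eqxx.
rewrite momentS /= IH (@moment_gt n n.+2) ?(@moment_gt n n.+1); try lia.
by rewrite mulr0 addr0 add0r.
Qed.

Lemma normc_moment k n : normc (moment k n) <= (M + 2) ^+ k.
Proof.
have M0 : 0 <= M by apply: le_trans (VM 0%N); exact: normr_ge0.
elim: k n => [|k IH] n.
  rewrite expr0 /moment /= /delta; case: (n == 0)%N.
    by rewrite mulr1n ComplexField.Normc.normc1.
  by rewrite mulr0n ComplexField.Normc.normc0.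
have K0 : 0 <= (M + 2) ^+ k by rewrite exprn_ge0 // addr_ge0.
have pred_le : normc (if n is m.+1 then moment k m else 0) <= (M + 2) ^+ k.
  by case: n => [|m]; rewrite ?ComplexField.Normc.normc0.
have V_le : normc ((V n)%:C * moment k n) <= M * (M + 2) ^+ k.
  by rewrite ComplexField.Normc.normcM normc_real ler_pM ?normc_ge0.
rewrite momentS exprS (_ : (M + 2) * _ =
  (M + 2) ^+ k + (M + 2) ^+ k + M * (M + 2) ^+ k); last by ring.
apply: (le_trans (le_normcD _ _)); apply: lerD V_le.
by apply: (le_trans (le_normcD _ _)); apply: lerD.
Qed.

Lemma jacobi_mul_col N (f : nat -> R[i]) (i : 'I_N.+1) :
  (jacobi V N N.+1 *m \col_(j < N.+1) f j) i 0 =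
  (if (i < N)%N then f i.+1 else 0) + (if (0 < i)%N then f i.-1 else 0) + (V i)%:C * f i.
Proof.
rewrite mxE.
transitivity (\sum_(j < N.+1)
   ((if j == i.+1 :> nat then f j else 0)
    + (if (0 < i)%N then if j == i.-1 :> nat then f j else 0 else 0)
    + (if j == i :> nat then (V i)%:C * f j else 0))).
  apply: eq_bigr => j _; rewrite !mxE !ltn_ord /= -val_eqE /= (eq_sym (nat_of_ord i) j).
  rewrite rmorphD /= mulrDl addrC; congr (_ + _); last first.
    by case: eqP => _; rewrite ?mul0r.
  have [e|ji] := eqVneq (nat_of_ord j) i.+1.
    rewrite rmorph1 mul1r; case: ltnP => i0; rewrite ?addr0 //.
    by rewrite e (_ : (i.+1 == i.-1) = false) ?addr0 //; lia.
  rewrite orFb add0r; have [e|ij] := eqVneq (nat_of_ord i) j.+1.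
    by rewrite e eqxx rmorph1 mul1r.
  rewrite rmorph0 mul0r; case: ltnP => // i0.
  by rewrite (_ : (j == i.-1 :> nat) = false) //; lia.
rewrite !big_split /=; congr (_ + _ + _).
- by rewrite (sum_delta_ord _ _ f) ltnS.
- case: ltnP => i0; last by rewrite big1.
  by rewrite (sum_delta_ord _ _ f) (leq_ltn_trans (leq_pred _) (ltn_ord i)).
- by rewrite (sum_delta_ord _ _ (fun j => (V i)%:C * f j)) ltn_ord.
Qed.

(** Within N steps from site 0 the right edge of the box is not felt, so box and half line agree. *)
Lemma jacobi_iter_site N k : (k <= N)%N ->
  jacobi V N N.+1 ^+ k *m site R N 0 = \col_(j < N.+1) moment k j.
Proof.
elim: k => [|k IH] kN.
  by rewrite expr0 mul1mx; apply/colP => i; rewrite !mxE.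
rewrite exprS -mulmxA IH; last exact: ltnW.
apply/colP => i; rewrite jacobi_mul_col mxE momentS; congr (_ + _ + _).
  case: ltnP => // Ni; rewrite moment_gt //; lia.
by case: (nat_of_ord i).
Qed.

(** Binomial expansion of the Euler scheme; the right-hand side does not depend on the box, which
    may therefore grow with m. *)
Lemma euler_iter_site N m (tau : R) (i : 'I_N.+1) : (m <= N)%N ->
  (euler_step tau (jacobi V N N.+1) ^+ m *m site R N 0) i 0 =
  \sum_(k < m.+1) (- ('i * tau%:C)) ^+ k * moment k i *+ 'C(m, k).
Proof.
move=> mN; rewrite /euler_step -scaleNr addrC exprD1n mulmx_suml summxE.
apply: eq_bigr => k _; rewrite exprZn -scaler_nat -!scalemxAl jacobi_iter_site; last first.
  by have := ltn_ord k; lia.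
by rewrite !mxE mulr_natl.
Qed.

Definition exp_term (t : R) n k : R[i] := (- ('i * t%:C)) ^+ k / (k`!)%:R * moment k n.

Lemma exp_partial_sumE t N n :
  exp_partial_sum V t (delta R 0) N n = \sum_(k < N) exp_term t n k.
Proof. by []. Qed.

Lemma normc_exp_term t n k : 0 <= t ->
  normc (exp_term t n k) <= exp_coeff (t * (M + 2)) k.
Proof.
move=> t0; rewrite /exp_term !ComplexField.Normc.normcM ComplexField.Normc.normcV.
rewrite normcX normcN ComplexField.Normc.normcM normc_real ger0_norm //.
rewrite (_ : normc 'i = 1); last by rewrite /= expr0n expr1n add0r sqrtr1.
rewrite -(rmorph_nat (real_complex R)) normc_real ger0_norm // mul1r.
rewrite /exp_coeff /= exprMn mulrAC; apply: ler_wpM2r; first by rewrite invr_ge0.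
by apply: ler_wpM2l (normc_moment _ _); exact: exprn_ge0.
Qed.

End Iterates.

(** * The limit of the exponential series *)

Section Evolution.
Local Open Scope classical_set_scope.
Local Open Scope ring_scope.
Local Open Scope complex_scope.
Variables (R : realType) (V : nat -> R) (M : R).
Hypothesis VM : forall n, `|V n| <= M.
Implicit Types (t : R) (n N : nat).

Lemma normr_Re_le (z : R[i]) : `|complex.Re z| <= normc z.
Proof.
rewrite -(ler_pXn2r (n := 2)) ?nnegrE ?normc_ge0 // normc_sqr.
by rewrite real_normK ?num_real // lerDl sqr_ge0.
Qed.

Lemma normr_Im_le (z : R[i]) : `|complex.Im z| <= normc z.
Proof.
rewrite -(ler_pXn2r (n := 2)) ?nnegrE ?normc_ge0 // normc_sqr.
by rewrite real_normK ?num_real // lerDr sqr_ge0.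
Qed.

Lemma normc_le_Re_Im (z : R[i]) : normc z <= `|complex.Re z| + `|complex.Im z|.
Proof.
rewrite -(ler_pXn2r (n := 2)) ?nnegrE ?normc_ge0 ?addr_ge0 // normc_sqr.
rewrite sqrrD !real_normK ?num_real // [leRHS]addrAC lerDl.
by rewrite mulrn_wge0 ?mulr_ge0.
Qed.

(** Coordinatewise candidate for e^{-itH} delta_0; real and imaginary parts are summed separately as
    real series. *)
Definition exp_limit t n : R[i] :=
  limn (series (fun k => complex.Re (exp_term V t n k))) +i*
  limn (series (fun k => complex.Im (exp_term V t n k))).

Lemma potential_bound_ge0 : 0 <= M + 2.
Proof. by rewrite addr_ge0 // (le_trans _ (VM 0%N)). Qed.

Lemma exp_limit_tail t n N y : 0 <= t -> 0 < y <= 1 ->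
  normc (exp_limit t n - exp_partial_sum V t (delta R 0) N n) <=
  2 * (y ^+ N * expR (t * (M + 2) / y)).
Proof.
move=> t0 y01; have x0 : 0 <= t * (M + 2) by rewrite mulr_ge0 // potential_bound_ge0.
have [|_ hR] := @series_exp_coeff_cvg R (t * (M + 2)) (fun k => complex.Re (exp_term V t n k)) _ x0.
  by move=> k; apply: le_trans (normr_Re_le _) (normc_exp_term VM _ _ _).
have [|_ hI] := @series_exp_coeff_cvg R (t * (M + 2)) (fun k => complex.Im (exp_term V t n k)) _ x0.
  by move=> k; apply: le_trans (normr_Im_le _) (normc_exp_term VM _ _ _).
rewrite exp_partial_sumE; set z := _ - _.
apply: (le_trans (normc_le_Re_Im z)).
have eR : complex.Re z = limn (series (fun k => complex.Re (exp_term V t n k)))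
    - \sum_(k < N) complex.Re (exp_term V t n k).
  by rewrite /z -Re_sum /exp_limit; case: (\sum_(k < N) _).
have eI : complex.Im z = limn (series (fun k => complex.Im (exp_term V t n k)))
    - \sum_(k < N) complex.Im (exp_term V t n k).
  by rewrite /z -Im_sum /exp_limit; case: (\sum_(k < N) _).
by rewrite -[2]/(1 + 1)%:R natrD mulrDl mul1r eR eI lerD ?hR ?hI.
Qed.

Lemma exp_partial_sum_small t n N : (N <= n)%N ->
  exp_partial_sum V t (delta R 0) N n = 0.
Proof.
move=> Nn; rewrite exp_partial_sumE big1 // => k _.
by rewrite /exp_term moment_gt ?mulr0 // (leq_trans (ltn_ord k)).
Qed.

(** Decay in N gives convergence, and decay in n makes it summable over the sites, hence convergence
    in l^2. Partial sums of at most n terms vanish at n, so N may be raised to max(N, n). *)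
Lemma exp_limit_decay t n N : 0 <= t ->
  normc (exp_limit t n - exp_partial_sum V t (delta R 0) N n) <=
  2 * expR (4 * (t * (M + 2))) * (2^-1 ^+ n * 2^-1 ^+ N).
Proof.
move=> t0.
have -> : exp_partial_sum V t (delta R 0) N n = exp_partial_sum V t (delta R 0) (maxn N n) n.
  by case: leqP => // Nn; rewrite !exp_partial_sum_small.
(* The rate 1/4 splits into one factor 1/2 for the decay in n and one for the decay in N. *)
have y01 : 0 < (4^-1 : R) <= 1 by rewrite invr_gt0 ltr0n invf_le1 ?ler1n.
apply: (le_trans (exp_limit_tail _ _ t0 y01)).
rewrite invrK [_ * 4]mulrC -[leRHS]mulrA ler_wpM2l // [leLHS]mulrC ler_wpM2l ?expR_ge0 //.
have -> : 4^-1 = 2^-1 * 2^-1 :> R by rewrite -invfM -natrM.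
rewrite exprMn ler_pM ?exprn_ge0 ?invr_ge0 //.
  by rewrite ler_wiXn2l ?invr_ge0 ?invf_le1 ?ler1n // leq_maxr.
by rewrite ler_wiXn2l ?invr_ge0 ?invf_le1 ?ler1n // leq_maxl.
Qed.

Lemma sum_half_pow n : \sum_(0 <= k < n) (2^-1 : R) ^+ k <= 2.
Proof.
suff -> : \sum_(0 <= k < n) (2^-1 : R) ^+ k = 2 - 2 * 2^-1 ^+ n.
  by rewrite gerBl mulr_ge0 // exprn_ge0 // invr_ge0.
elim: n => [|n IH]; first by rewrite big_geq // expr0 mulr1 subrr.
by rewrite big_nat_recr //= IH exprS; field.
Qed.

Lemma sqnorm_le (psi : nat -> R[i]) (C : R) : 0 <= C ->
  (forall n, normc (psi n) <= C * 2^-1 ^+ n) ->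
  (sqnorm psi <= (2 * C ^+ 2)%:E)%E.
Proof.
move=> C0 h; apply: lime_le; first by apply: is_cvg_nneseries => n _ _; rewrite lee_fin sqr_ge0.
near=> N; rewrite sumEFin lee_fin mulrC.
apply: le_trans (ler_wpM2l (sqr_ge0 C) (sum_half_pow N)).
rewrite mulr_sumr; apply: ler_sum => n _.
have p0 : 0 <= (2^-1 : R) ^+ n by rewrite exprn_ge0 // invr_ge0.
apply: (@le_trans _ _ ((C * 2^-1 ^+ n) ^+ 2)).
  by rewrite lerXn2r ?nnegrE ?normc_ge0 ?mulr_ge0.
rewrite exprMn ler_wpM2l ?sqr_ge0 // expr2 -[leRHS]mulr1 ler_wpM2l //.
by rewrite exprn_ile1 ?invr_ge0 ?invf_le1 ?ler1n.
Unshelve. all: by end_near. Qed.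

Lemma normc_le_sqnorm (psi : nat -> R[i]) n : ((normc (psi n) ^+ 2)%:E <= sqnorm psi)%E.
Proof.
rewrite /sqnorm; apply: le_trans (nneseries_lim_ge n.+1 _); last first.
  by move=> k _ _; rewrite lee_fin sqr_ge0.
rewrite big_nat_recr //= leeDr //; apply: sume_ge0 => k _.
by rewrite lee_fin sqr_ge0.
Qed.

Lemma cvg_half_pow : ((2^-1 : R) ^+ n) @[n --> \oo] --> (0 : R).
Proof. by apply: cvg_expr; rewrite ger0_norm ?invr_ge0 // invf_lt1 ?ltr1n. Qed.

(** Shows that the set in [evolution] is inhabited, so that [xget] does not return its default. *)
Lemma exp_limit_mem t : 0 <= t ->
  [set phi | l2 phi /\
    (fun N => sqnorm (fun n => exp_partial_sum V t (delta R 0) N n - phi n)) @ \oo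
      --> (0 : \bar R)] (exp_limit t).
Proof.
move=> t0; set C := 2 * expR (4 * (t * (M + 2))).
have C0 : 0 <= C by rewrite mulr_ge0 // expR_ge0.
have half_ge0 N : 0 <= (2^-1 : R) ^+ N by rewrite exprn_ge0 // invr_ge0.
split.
  rewrite /l2 /=; apply: (@le_lt_trans _ _ (2 * C ^+ 2)%:E); last by rewrite ltry.
  apply: sqnorm_le => // n; have := exp_limit_decay n 0 t0.
  by rewrite exp_partial_sum_small // subr0 expr0 mulr1.
apply: (@squeeze_cvge _ _ _ _ (cst 0%E) _ (fun N => (2 * (C * 2^-1 ^+ N) ^+ 2)%:E)).
- near=> N; apply/andP; split; first by apply: nneseries_ge0 => n _ _; rewrite lee_fin sqr_ge0.
  apply: sqnorm_le; first by rewrite mulr_ge0.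
  move=> n; rewrite -opprB normcN (le_trans (exp_limit_decay n N t0)) //.
  by rewrite -/C [_ ^+ n * _]mulrC mulrA.
- exact: cvg_cst.
apply: cvg_EFin; first by near=> N.
rewrite (_ : 0 = 2 * (C * 0) ^+ 2); last by rewrite mulr0 expr0n mulr0.
apply: cvgMr; apply: (@cvg_comp _ _ _ _ (fun x => x ^+ 2)); last exact: exprn_continuous.
by apply: cvgMr; exact: cvg_half_pow.
Unshelve. all: by end_near. Qed.

(** Convergence in l^2 forces convergence of each coordinate, and limits are unique, so whatever
    element [xget] picks agrees with [exp_limit]. *)
Lemma evolutionE t n : 0 <= t -> evolution V t (delta R 0) n = exp_limit t n.
Proof.
move=> t0; rewrite /evolution; case: xgetP => [phi _ [_ phi_lim]|/(_ (exp_limit t))]; last first.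
  by have := exp_limit_mem t0.
have [_ lim_lim] := exp_limit_mem t0.
suff /ComplexField.Normc.eq0_normc/eqP : normc (phi n - exp_limit t n) = 0.
  by rewrite subr_eq0 => /eqP.
set d := normc _.
pose S N := exp_partial_sum V t (delta R 0) N n.
have coord (f : nat -> R[i]) :
    (fun N => sqnorm (fun n => exp_partial_sum V t (delta R 0) N n - f n)) @ \oo --> (0 : \bar R) ->
    (fun N => normc (S N - f n) ^+ 2) @ \oo --> (0 : R).
  move=> fl; apply: (@fine_cvg _ _ _ _ (fun N => (normc (S N - f n) ^+ 2)%:E)).
  apply: squeeze_cvge (cvg_cst _) fl.
  near=> N; rewrite /= lee_fin sqr_ge0 /=.
  exact: (@normc_le_sqnorm (fun n => exp_partial_sum V t (delta R 0) N n - f n) n).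
have dS : (fun N => 2 * (normc (S N - phi n) ^+ 2 + normc (S N - exp_limit t n) ^+ 2)) @ \oo
    --> (0 : R).
  rewrite (_ : 0 = 2 * (0 + 0)); last by rewrite addr0 mulr0.
  by apply: cvgMr; apply: cvgD; apply: coord.
have d0 : d ^+ 2 <= 0.
  rewrite -(cvg_lim _ dS) //; apply: limr_ge; first by apply/cvg_ex; eexists; exact: dS.
  near=> N; have : d <= normc (S N - phi n) + normc (S N - exp_limit t n).
    rewrite -[normc (S N - phi n)]normcN; apply: le_trans (le_normcD _ _).
    by rewrite opprB addrA subrK.
  have dge : 0 <= d by exact: normc_ge0.
  have := sqr_ge0 (normc (S N - phi n) - normc (S N - exp_limit t n)).
  by nra.
by apply/eqP; rewrite -sqrf_eq0 eq_le d0 sqr_ge0.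
Unshelve. all: by end_near. Qed.

Lemma amplitudeE t n : 0 <= t -> amplitude V n t = normc (exp_limit t n).
Proof.
move=> t0; rewrite /amplitude -evolutionE //; congr (normc _).
(* The partial sums of an inner product with [delta n] are constant once they include the index
   n. *)
apply: (@norm_lim_near_cst (R[i]) (R[i]^o)); near=> N; rewrite /series /=.
have nN : (n < N)%N by near: N; exact: nbhs_infty_gt.
rewrite (bigD1_seq n) ?mem_index_iota ?iota_uniq //= big1 => [|k kn].
  by rewrite /delta rmorph_nat eqxx mul1r addr0.
by rewrite /delta rmorph_nat (negPf kn) mul0r.
Unshelve. all: by end_near. Qed.
End Evolution.

(** * Amplitudes as limits of the Euler scheme *)

Section AmplitudeBounds.
Local Open Scope classical_set_scope.
Local Open Scope ring_scope.
Local Open Scope complex_scope.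
Variables (R : realType) (V : nat -> R) (M : R).
Hypothesis VM : forall n, `|V n| <= M.
Implicit Types (t : R) (n N m k : nat).

Lemma normc_cvg (z : nat -> R[i]) (l : R[i]) (d : R ^nat) :
  (forall m, normc (l - z m) <= d m) -> d @ \oo --> (0 : R) ->
  (fun m => normc (z m)) @ \oo --> normc l.
Proof.
move=> zd d0.
apply: (@squeeze_cvgr _ _ _ _ (fun m => normc l - d m) (fun m => normc l + d m)).
- near=> m; apply/andP; split.
    rewrite lerBlDr (le_trans _ (lerD (lexx _) (zd m))) //.
    by rewrite -{1}[l](subrK (z m)) addrC le_normcD.
  apply: le_trans (lerD (lexx _) (zd m)).
  by rewrite -{1}[z m](subKr l) -[normc (l - z m)]normcN le_normcD.
- by rewrite -[X in _ --> X]subr0; apply: cvgB => //; exact: cvg_cst.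
- by rewrite -[X in _ --> X]addr0; apply: cvgD => //; exact: cvg_cst.
Unshelve. all: by end_near. Qed.

Lemma normc_exp_partial_sum_cvg t n : 0 <= t ->
  (fun N => normc (exp_partial_sum V t (delta R 0) N n)) @ \oo --> amplitude V n t.
Proof.
move=> t0; rewrite (amplitudeE VM) //.
apply: (normc_cvg (fun N => exp_limit_decay VM n N t0)).
rewrite [X in _ --> X](_ : _ = 2 * expR (4 * (t * (M + 2))) * (2^-1 ^+ n * 0)); last first.
  by rewrite !mulr0.
by apply: cvgMr; apply: cvgMr; exact: cvg_half_pow.
Qed.

(** Component at n of the m-step Euler scheme on the half line, in the expanded form of
    [euler_iter_site] with tau = t/m. *)
Definition euler_sum m t n : R[i] :=
  \sum_(k < m.+1) (- ('i * (t / m%:R)%:C)) ^+ k * moment V k n *+ 'C(m, k).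

Lemma bin_le_expn_fact m k : ('C(m, k) * k`! <= m ^ k)%N.
Proof.
rewrite bin_ffact; elim: k => [|k IH]; first by rewrite ffactn0.
by rewrite ffactnSr expnSr leq_mul // leq_subr.
Qed.

(** The coefficients of the two sums differ by 1/k! - C(m, k)/m^k, which is nonnegative; as moments
    of order k are at most (M + 2)^k, the difference is dominated by its scalar analogue at x = t (M
    + 2). *)
Lemma exp_partial_sum_euler t n m : 0 <= t -> (0 < m)%N -> t * (M + 2) <= m%:R ->
  normc (exp_partial_sum V t (delta R 0) m.+1 n - euler_sum m t n) <=
  expR (t * (M + 2)) * (t * (M + 2)) ^+ 2 / m%:R.
Proof.
move=> t0 m0 tm; have mR : 0 < m%:R :> R by rewrite ltr0n.
set x := t * (M + 2) in tm *.
have x0 : 0 <= x by rewrite mulr_ge0 // (potential_bound_ge0 VM).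
apply: le_trans (expR_sub_euler_le m0 tm x0).
rewrite exp_partial_sumE -sumrB; apply: (le_trans (le_normc_sum _ _)).
have -> : (1 + x / m%:R) ^+ m = \sum_(k < m.+1) (x / m%:R) ^+ k *+ 'C(m, k).
  by rewrite addrC exprD1n.
rewrite lerBrDr; apply: le_trans (sum_exp_coeff_le m.+1 x0).
rewrite -big_split; apply: ler_sum => k _ /=; rewrite -lerBrDr.
pose g : R := (k`!)%:R^-1 - m%:R^-1 ^+ k * 'C(m, k)%:R.
have g0 : 0 <= g.
  have kf : 0 < (k`!)%:R :> R by rewrite ltr0n fact_gt0.
  rewrite subr_ge0 exprVn mulrC ler_pdivrMr ?exprn_gt0 // mulrC ler_pdivlMr //.
  by rewrite -natrM -natrX ler_nat bin_le_expn_fact.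
have -> : exp_term V t n k - (- ('i * (t / m%:R)%:C)) ^+ k * moment V k n *+ 'C(m, k) =
    (- ('i * t%:C)) ^+ k * moment V k n * g%:C.
  rewrite /exp_term -[_ *+ 'C(m, k)]mulr_natr.
  have -> : - ('i * (t / m%:R)%:C) = - ('i * t%:C) * (m%:R^-1)%:C :> R[i].
    by rewrite rmorphM /= mulrA mulNr.
  rewrite exprMn /g rmorphB rmorphM rmorphXn /= (fmorphV _ (k`!)%:R) !rmorph_nat; ring.
have -> : exp_coeff x k - (x / m%:R) ^+ k *+ 'C(m, k) = x ^+ k * g.
  by rewrite /exp_coeff /= /g -[_ *+ _]mulr_natr [(x / _) ^+ k]exprMn; ring.
rewrite !ComplexField.Normc.normcM normc_real (ger0_norm g0) ler_wpM2r //.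
rewrite normcX normcN ComplexField.Normc.normcM normc_real ger0_norm //.
rewrite (_ : normc 'i = 1); last by rewrite /= expr0n expr1n add0r sqrtr1.
by rewrite mul1r /x exprMn ler_wpM2l ?exprn_ge0 // normc_moment.
Qed.

Lemma normc_euler_sum_cvg t n : 0 <= t ->
  (fun m => normc (euler_sum m t n)) @ \oo --> amplitude V n t.
Proof.
move=> t0; rewrite (amplitudeE VM) //; set x := t * (M + 2).
(* The error bound needs m positive and at least x, so the sequence is shifted by [m0.+1]. *)
have [m0 m0x] : exists m0, forall m, x <= (m + m0.+1)%:R.
  exists (Num.bound x) => m; apply: ltW; apply: (lt_le_trans (_ : x < (Num.bound x)%:R)).
    apply: archi_boundP; by rewrite mulr_ge0 // (potential_bound_ge0 VM).
  by rewrite ler_nat; lia.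
rewrite -(cvg_shiftn m0.+1).
pose C := 2 * expR (4 * (t * (M + 2))).
pose d m := C * (2^-1 ^+ n * 2^-1 ^+ (m + m0.+1).+1) + expR x * x ^+ 2 * (m + m0.+1)%:R^-1.
apply: (@normc_cvg (fun m => euler_sum (m + m0.+1) t n) _ d).
  move=> m; set k := (m + m0.+1)%N.
  rewrite -[exp_limit _ _ _](subrK (exp_partial_sum V t (delta R 0) k.+1 n)) -addrA.
  apply: (le_trans (le_normcD _ _)); apply: lerD; first exact: exp_limit_decay.
  by apply: exp_partial_sum_euler; rewrite // /k ?m0x // addnS.
rewrite (_ : 0 = C * (2^-1 ^+ n * 0) + expR x * x ^+ 2 * 0); last by rewrite !mulr0 addr0.
apply: cvgD; apply: cvgMr.
  apply: cvgMr; have := @cvg_half_pow R; rewrite -(cvg_shiftn m0.+2).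
  by under eq_fun do rewrite addnS.
have := @cvg_harmonic R; rewrite -(cvg_shiftn m0).
by under eq_fun do rewrite /harmonic /= -addnS.
Qed.

End AmplitudeBounds.

(** * Bounds on amplitudes and on the outside probability *)

Section OuterAmplitude.
Local Open Scope classical_set_scope.
Local Open Scope ring_scope.
Local Open Scope complex_scope.
Variables (R : realType) (V : nat -> R) (M : R).
Hypothesis VM : forall n, `|V n| <= M.
Implicit Types (t : R) (n N m k : nat).

Lemma cvg_sum_nat (a b : nat) (f : nat -> R ^nat) (l : nat -> R) :
  (forall k, f k @ \oo --> l k) ->
  (fun m => \sum_(a <= k < b) f k m) @ \oo --> \sum_(a <= k < b) l k.
Proof.
move=> fl; elim: (index_iota a b) => [|k s IH].
  rewrite big_nil; under eq_fun do rewrite big_nil; exact: cvg_cst.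
rewrite big_cons; under eq_fun do rewrite big_cons.
by apply: cvgD => //; exact: fl.
Qed.

Lemma expR_half_le2 : expR (2^-1 : R) <= 2.
Proof.
have h := expR_ge1Dx (- 2^-1 : R).
have e0 : 0 < expR (2^-1 : R) by exact: expR_gt0.
have : expR (2^-1 : R) * expR (- 2^-1) = 1 by rewrite expRN divff // gt_eqF.
nra.
Qed.

Lemma pow_1D_le_expR (y : R) m : 0 <= y -> (1 + y) ^+ m <= expR (m%:R * y).
Proof.
move=> y0; rewrite expRM_natl lerXn2r ?nnegrE ?addr_ge0 ?expR_ge0 //.
exact: expR_ge1Dx.
Qed.

Lemma outer_euler_sum_le n (b t : R) N :
  (forall j, (j < n.+2)%N -> band_width V n.+2 j <= b) -> 0 <= t ->
  \forall m \near \oo,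
  \sum_(n.+2 <= k < N) normc (euler_sum V m t k) ^+ 2 <=
  (n.+2%:R * b * t * expR (2 * n.+2%:R * b * t) * (3 + 2 * t)) ^+ 2.
Proof.
move=> bw t0; set q := n.+2.
have b0 : 0 <= b by apply: le_trans (bw 0%N isT); exact: normr_ge0.
pose e j := band_edge V q j 0; pose e' j := band_edge V q j pi.
(* K dominates both the row sums of H and the roots e j, so one growth factor c serves the matrix
   and the scalar Euler steps. *)
pose K := M + 2 + \sum_(j < q) `|e j|.
have M2 : 0 <= M + 2 := potential_bound_ge0 VM.
have MK : M + 2 <= K by rewrite lerDl sumr_ge0.
have K0 : 0 <= K by exact: le_trans MK.
have eK j : (j < q)%N -> `|e j| <= K.
  move=> jq; rewrite /K (bigD1 (Ordinal jq)) //= addrCA lerDl.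
  by rewrite addr_ge0 // sumr_ge0.
near=> m.
have m0 : (0 < m)%N by near: m; exact: nbhs_infty_gt.
have mR : 0 < m%:R :> R by rewrite ltr0n.
(* Gives c^m <= exp((t K)^2 / m) <= e^(1/2) <= 2 below. *)
have tKm : 2 * (t * K) ^+ 2 <= m%:R by near: m; exact: nbhs_infty_ger.
pose tau := t / m%:R.
have tau0 : 0 <= tau by rewrite divr_ge0.
have mtau : m%:R * tau = t by rewrite /tau mulrC divfK // gt_eqF.
pose c := 1 + (tau * K) ^+ 2; pose L := c ^+ m.
have c1 : 1 <= c by rewrite lerDl sqr_ge0.
have cK : 1 + (tau * K) ^+ 2 <= c ^+ 2 by rewrite expr2 ler_peMl // (le_trans _ c1).
have L0 : 0 <= L by rewrite exprn_ge0 // (le_trans _ c1).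
have L2 : L <= 2.
  apply: (le_trans (pow_1D_le_expR m (sqr_ge0 _))); apply: le_trans expR_half_le2.
  rewrite ler_expR (_ : _ * _ = (t * K) ^+ 2 / m%:R); last first.
    by rewrite /tau; field; rewrite gt_eqF.
  by rewrite ler_pdivrMr // ler_pdivlMl.
(* The box must hold the m Euler steps, the q sites of the period and all sites of the sum. *)
pose NN := (m + q + N)%N.
have bw' j : (j < q)%N -> `|e j - e' j| <= b by move=> jq; rewrite distrC; exact: bw.
have qNN : (q <= NN)%N := leq_trans (leq_addl m q) (leq_addr N (m + q)).
have := nrm_outer_euler m VM MK eK tau0 c1 cK qNN
  (prod_band_edge0 V n) (prod_band_edgepi V n) bw'.
set u := _ *m _; rewrite -/L mtau => hu.
have nrm_le : nrm u <= q%:R * b * t * expR (2 * q%:R * b * t) * (3 + 2 * t).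
  apply: (le_trans hu).
  have btL : b * (t * L) <= 2 * (b * t).
    by rewrite mulrA mulrC ler_wpM2r // mulr_ge0.
  have btL0 : 0 <= b * (t * L) by rewrite !mulr_ge0.
  have bt0 : 0 <= 2 * (b * t) by rewrite !mulr_ge0.
  have p1 : (1 + b * (t * L)) ^+ q <= expR (2 * q%:R * b * t).
    apply: (@le_trans _ _ ((1 + 2 * (b * t)) ^+ q)).
      by rewrite lerXn2r ?nnegrE ?addr_ge0 // lerD2l.
    apply: (le_trans (pow_1D_le_expR q bt0)).
    by rewrite (_ : q%:R * _ = 2 * q%:R * b * t) //; ring.
  have tL : 3 * L + t * L * L <= 2 * (3 + 2 * t).
    have : t * L * L <= t * 2 * 2 by rewrite -!mulrA ler_wpM2l // ler_pM.
    by lra.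
  have tL0 : 0 <= 3 * L + t * L * L by rewrite addr_ge0 // !mulr_ge0.
  rewrite ler_pdivrMr //.
  have -> : q%:R * b * t * expR (2 * q%:R * b * t) * (3 + 2 * t) * 4 =
     q%:R * (2 * (b * t)) * expR (2 * q%:R * b * t) * (2 * (3 + 2 * t)) by ring.
  have P0 : 0 <= (1 + b * (t * L)) ^+ q by rewrite exprn_ge0 // addr_ge0.
  have q0 : 0 <= q%:R * (b * (t * L)) by rewrite mulr_ge0.
  apply: ler_pM => //; first exact: mulr_ge0.
  apply: ler_pM => //.
  by rewrite ler_wpM2l.
apply: (@le_trans _ _ (nrm u ^+ 2)); last first.
  by rewrite lerXn2r ?nnegrE ?nrm_ge0 // (le_trans (nrm_ge0 u)).
pose f k := if (q <= k)%N then normc (euler_sum V m t k) ^+ 2 else 0.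
have f0 k : 0 <= f k by rewrite /f; case: ifP => // _; exact: sqr_ge0.
have -> : nrm u ^+ 2 = \sum_(0 <= k < NN.+1) f k.
  rewrite nrm_sqr big_mkord; apply: eq_bigr => i _.
  rewrite /u outerE /f; case: ifP => _; last first.
    by rewrite ComplexField.Normc.normc0 expr0n.
  by rewrite euler_iter_site // /NN -addnA leq_addr.
have [Nq|qN] := leqP N q; first by rewrite big_geq // sumr_ge0.
rewrite [leRHS](big_cat_nat (n := q)) ?leq0n //=; last by rewrite ltnW.
rewrite [X in _ <= _ + X](big_cat_nat (n := N)) ?(ltnW qN) //=; last first.
  exact: leq_trans (leq_addl (m + q) N) (leqnSn _).
rewrite addrCA.
have -> : \sum_(q <= k < N) normc (euler_sum V m t k) ^+ 2 = \sum_(q <= k < N) f k.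
  by apply: eq_big_nat => k /andP[qk _]; rewrite /f qk.
by rewrite lerDl addr_ge0 // sumr_ge0.
Unshelve. all: by end_near. Qed.

Lemma outer_amplitude_le n (b t : R) N :
  (forall j, (j < n.+2)%N -> band_width V n.+2 j <= b) -> 0 <= t ->
  \sum_(n.+2 <= k < N) amplitude V k t ^+ 2 <=
  (n.+2%:R * b * t * expR (2 * n.+2%:R * b * t) * (3 + 2 * t)) ^+ 2.
Proof.
move=> bw t0.
have cv : (fun m => \sum_(n.+2 <= k < N) normc (euler_sum V m t k) ^+ 2) @ \oo -->
    \sum_(n.+2 <= k < N) amplitude V k t ^+ 2.
  apply: cvg_sum_nat => k.
  apply: (@cvg_comp _ _ _ _ (fun x => x ^+ 2)); last exact: exprn_continuous.
  exact: normc_euler_sum_cvg.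
rewrite -(cvg_lim _ cv) //; apply: limr_le; first by apply/cvg_ex; eexists; exact: cv.
exact: outer_euler_sum_le.
Qed.

(** Site n is first reached at order n, with a term of modulus t^n/n!; the rest is the tail of the
    series, estimated with y = t (M + 2), for which the constant [expR (x / y)] is [expR 1]. *)
Lemma amplitude_ge n t : 0 < t -> t * (M + 2) <= 1 ->
  t ^+ n / (n`!)%:R - 2 * expR 1 * (t * (M + 2)) ^+ n.+1 <= amplitude V n t.
Proof.
move=> t0 tK; rewrite (amplitudeE VM) ?(ltW t0) //.
have y0 : 0 < t * (M + 2).
  have M0 : 0 <= M := le_trans (normr_ge0 _) (VM 0%N).
  by rewrite mulr_gt0 // ltr_wpDl.
have y01 : 0 < t * (M + 2) <= 1 by rewrite y0.
have := exp_limit_tail VM n n.+1 (ltW t0) y01.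
rewrite divff ?gt_eqF // (_ : 2 * (_ * _) = 2 * expR 1 * (t * (M + 2)) ^+ n.+1); last by ring.
move=> tail.
rewrite lerBlDr; apply: le_trans (lerD (lexx _) tail).
have -> : t ^+ n / (n`!)%:R = normc (exp_partial_sum V t (delta R 0) n.+1 n).
  rewrite exp_partial_sumE big_ord_recr big1 /= => [|k _].
    rewrite add0r /exp_term moment_diag mulr1 ComplexField.Normc.normcM.
    rewrite normcX normcN ComplexField.Normc.normcM normc_real (ger0_norm (ltW t0)).
    rewrite (_ : normc 'i = 1); last by rewrite /= expr0n expr1n add0r sqrtr1.
    rewrite mul1r ComplexField.Normc.normcV -(rmorph_nat (real_complex R)) normc_real.
    by rewrite ger0_norm.
  by rewrite /exp_term moment_gt ?mulr0.
rewrite -{1}[exp_partial_sum _ _ _ _ _](subKr (exp_limit V t n)).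
by rewrite -[normc (exp_limit V t n - _)]normcN; exact: le_normcD.
Qed.

(** Pointwise limit on t >= 0 of polynomials in t, the squared moduli of the partial sums of the
    exponential series. *)
Lemma measurable_amplitude_sqr n :
  measurable_fun `[(0 : R), +oo[ (fun t => amplitude V n t ^+ 2).
Proof.
pose z (k : nat) : R[i] := (- 'i) ^+ k / (k`!)%:R * moment V k n.
pose h (N : nat) t := (\sum_(k < N) t ^+ k * complex.Re (z k)) ^+ 2 +
  (\sum_(k < N) t ^+ k * complex.Im (z k)) ^+ 2.
have hE N t : h N t = normc (exp_partial_sum V t (delta R 0) N n) ^+ 2.
  have e k : exp_term V t n k = (t ^+ k)%:C * z k.
    by rewrite /exp_term /z -mulNr exprMn rmorphXn /=; ring.
  rewrite normc_sqr exp_partial_sumE Re_sum Im_sum /h.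
  congr (_ ^+ 2 + _ ^+ 2); apply: eq_bigr => k _; rewrite e.
    by case: (z k) => x y /=; ring.
  by case: (z k) => x y /=; ring.
apply: (@measurable_fun_cvg _ _ _ _ h) => [N|t].
  apply: measurable_funD; apply: measurable_funX; apply: measurable_sum => k;
  by apply: measurable_funM => //; apply: measurable_funX.
rewrite /= in_itv /= andbT => t0.
under eq_fun do rewrite hE.
apply: (@cvg_comp _ _ _ _ (fun x => x ^+ 2)); last exact: exprn_continuous.
exact: normc_exp_partial_sum_cvg.
Qed.

End OuterAmplitude.

(** * Time averages: upper bound and positivity of the outside probability *)

Section OutsideProbability.
Local Open Scope classical_set_scope.
Local Open Scope ring_scope.
Local Open Scope complex_scope.
Variables (R : realType) (V : nat -> R) (M : R).
Hypothesis VM : forall n, `|V n| <= M.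
Implicit Types (t T : R) (n N m k : nat).

Let mu := @lebesgue_measure R.
Let halfline : set R := `[0, +oo[.

Lemma measurable_halfline : measurable halfline. Proof. exact: measurable_itv. Qed.

Lemma integral_exp_halfline (r C : R) : 0 < r -> 0 <= C ->
  (\int[mu]_(t in halfline) (C * expR (- r * t))%:E = (C / r)%:E)%E.
Proof.
move=> r0 C0.
have e : (\int[mu]_(t in halfline) (r * expR (- r * t))%:E = 1)%E.
  rewrite -(integral_exponential_pdf r0) integral_mkcond.
  by apply: eq_integral => t _; rewrite /exponential_pdf !patchE; case: ifP.
have -> : (\int[mu]_(t in halfline) (C * expR (- r * t))%:E =
    \int[mu]_(t in halfline) ((C / r)%:E * (r * expR (- r * t))%:E))%E.
  by apply: eq_integral => t _; rewrite -EFinM mulrA divfK ?gt_eqF.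
rewrite ge0_integralZl_EFin ?e ?mule1 //.
- exact: measurable_halfline.
- by move=> t _; rewrite lee_fin mulr_ge0 ?expR_ge0 // ltW.
- apply/measurable_EFinP/measurable_funM => //.
  by apply/measurable_funTS/measurableT_comp => //; apply: measurable_funM.
- by rewrite divr_ge0 // ltW.
Qed.

Definition weighted n T t : R := amplitude V n t ^+ 2 * expR (- (2 * t / T)).

Lemma weighted_ge0 n T t : 0 <= weighted n T t.
Proof. by rewrite mulr_ge0 ?sqr_ge0 // expR_ge0. Qed.

Lemma measurable_weighted n T : measurable_fun halfline (fun t => (weighted n T t)%:E).
Proof.
apply/measurable_EFinP; apply: measurable_funM; first exact: (measurable_amplitude_sqr VM).
apply/measurable_funTS/measurableT_comp => //; apply: measurableT_comp => //.
by apply: measurable_funM => //; apply: measurable_funM.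
Qed.

(** In the scale y = t/T the amplitude bound grows at most like e^(3y/4); after squaring, the weight
    e^(-2y) still leaves the integrable factor e^(-y/2). *)
Lemma weighted_sum_le n (b T t : R) N :
  (forall j, (j < n.+2)%N -> band_width V n.+2 j <= b) -> 1 <= T ->
  4 * n.+2%:R * b * T <= 1 -> 0 <= t ->
  \sum_(n.+2 <= k < N) weighted k T t <=
  128 ^+ 2 * (n.+2%:R * b) ^+ 2 * T ^+ 4 * expR (- (2 * T)^-1 * t).
Proof.
move=> bw T1 bT t0; set q : R := n.+2%:R in bT *.
have b0 : 0 <= b by apply: le_trans (bw 0%N isT); exact: normr_ge0.
have T0 : 0 < T by exact: lt_le_trans T1.
rewrite /weighted -mulr_suml.
pose y := t / T; have y0 : 0 <= y by rewrite divr_ge0 // ltW.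
have tE : t = T * y by rewrite /y mulrC divfK // gt_eqF.
apply: (le_trans (ler_wpM2r (expR_ge0 _) (outer_amplitude_le VM N bw t0))).
rewrite -/q.
have E1 : expR (2 * q * b * t) <= expR (y / 2).
  rewrite ler_expR tE (_ : 2 * q * b * (T * y) = (4 * q * b * T) * (y / 2)); last by field.
  by rewrite ler_piMl // divr_ge0.
(* The constant 128 comes from 3 y + 2 y^2 <= 128 (1 + y/8)^2. *)
have E2 : t * (3 + 2 * t) <= T ^+ 2 * 128 * expR (y / 4).
  have e8 : 1 + y / 8 <= expR (y / 8) by exact: expR_ge1Dx.
  have -> : expR (y / 4) = expR (y / 8) ^+ 2 by rewrite -expRM_natl; congr expR; field.
  apply: (@le_trans _ _ (T ^+ 2 * (3 * y + 2 * y ^+ 2))).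
    rewrite tE (_ : _ * _ = T * (3 * y) + T ^+ 2 * (2 * y ^+ 2)); last by ring.
    rewrite mulrDr lerD2r expr2 -mulrA ler_wpM2l ?(ltW T0) // ler_peMl //.
    by rewrite mulr_ge0.
  rewrite -mulrA ler_wpM2l ?sqr_ge0 //.
  have : (1 + y / 8) ^+ 2 <= expR (y / 8) ^+ 2.
    have y8 : 0 <= y / 8 by exact: divr_ge0.
    by rewrite lerXn2r // ?nnegrE ?addr_ge0 ?expR_ge0.
  by move=> h; nra.
have qb0 : 0 <= q * b by rewrite mulr_ge0.
have B : q * b * t * expR (2 * q * b * t) * (3 + 2 * t) <=
    q * b * (T ^+ 2 * 128) * expR (y * 3 / 4).
  rewrite (_ : q * b * t * _ * _ =
      q * b * ((t * (3 + 2 * t)) * expR (2 * q * b * t))); last by ring.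
  rewrite (_ : y * 3 / 4 = y / 4 + y / 2); last by field.
  rewrite expRD (_ : q * b * _ * _ =
      q * b * (T ^+ 2 * 128 * expR (y / 4) * expR (y / 2))); last by ring.
  by rewrite ler_wpM2l // ler_pM ?expR_ge0 // mulr_ge0 // addr_ge0 // mulr_ge0.
have B0 : 0 <= q * b * t * expR (2 * q * b * t) * (3 + 2 * t).
  by rewrite !mulr_ge0 ?expR_ge0 // addr_ge0 // mulr_ge0.
apply: (@le_trans _ _ ((q * b * (T ^+ 2 * 128) * expR (y * 3 / 4)) ^+ 2 * expR (- (2 * t / T)))).
  rewrite ler_wpM2r ?expR_ge0 // lerXn2r ?nnegrE //; exact: le_trans B.
have expE (a z w : R) : (a * expR z) ^+ 2 * expR w = a ^+ 2 * expR (2 * z + w).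
  by rewrite exprMn -mulrA -expRM_natl -expRD.
rewrite expE le_eqVlt; apply/orP; left; apply/eqP.
congr (_ * _); first by ring.
by congr expR; rewrite /y; field; rewrite gt_eqF.
Qed.

Lemma outside_prob_le n (b T y : R) :
  (forall j, (j < n.+2)%N -> band_width V n.+2 j <= b) -> 1 <= T ->
  4 * n.+2%:R * b * T <= 1 -> n.+2%:R <= y ->
  (outside_prob V y T <= (256 ^+ 2 * (n.+2%:R * b) ^+ 2 * T ^+ 4)%:E)%E.
Proof.
move=> bw T1 bT qy; set q := n.+2 in bT *.
have T0 : 0 < T by exact: lt_le_trans T1.
have T20 : 0 <= 2 / T by rewrite divr_ge0 // ltW.
pose A k : \bar R := (\int[mu]_(t in halfline) (weighted k T t)%:E)%E.
have A0 k : (0 <= A k)%E by apply: integral_ge0 => t _; rewrite lee_fin weighted_ge0.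
rewrite /outside_prob; apply: lime_le.
  by apply: is_cvg_nneseries => k _ _; rewrite mule_ge0 ?lee_fin //; exact: A0.
near=> N.
apply: (@le_trans _ _ (\sum_(q <= k < N) ((2 / T)%:E * A k))%E).
  (* Only sites k with y < k + 1 enter, and q <= y then forces q <= k. *)
  rewrite [leRHS](big_nat_widenl q 0%N) // [leLHS]big_mkcond [leRHS]big_mkcond /=.
  apply: lee_sum => k _; case: ifPn => [yk|_]; last first.
    by case: ifP => _ //; rewrite mule_ge0 ?lee_fin.
  rewrite ifT //; have := le_lt_trans qy yk; rewrite ltr_nat ltnS //.
rewrite -ge0_sume_distrr //.
have -> : (\sum_(q <= k < N) A k =
    \int[mu]_(t in halfline) (\sum_(q <= k < N) weighted k T t)%:E)%E.
  rewrite /A -ge0_integral_sum //.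
  - by apply: eq_integral => t _; rewrite sumEFin.
  - exact: measurable_halfline.
  - by move=> k; exact: measurable_weighted.
  - by move=> k t _; rewrite lee_fin weighted_ge0.
set C := 128 ^+ 2 * (q%:R * b) ^+ 2 * T ^+ 4.
have C0 : 0 <= C.
  apply: mulr_ge0; last by rewrite exprn_ge0 // ltW.
  by apply: mulr_ge0; exact: sqr_ge0.
have r0 : 0 < (2 * T)^-1 by rewrite invr_gt0 mulr_gt0.
have le_int : (\int[mu]_(t in halfline) (\sum_(q <= k < N) weighted k T t)%:E <=
    \int[mu]_(t in halfline) (C * expR (- (2 * T)^-1 * t))%:E)%E.
  apply: ge0_le_integral.
  - exact: measurable_halfline.
  - by move=> t _; rewrite lee_fin sumr_ge0 // => k _; exact: weighted_ge0.
  - under eq_fun do rewrite -sumEFin.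
    by apply: emeasurable_sum => k; exact: measurable_weighted.
  - apply/measurable_EFinP/measurable_funM => //.
    by apply/measurable_funTS/measurableT_comp => //; apply: measurable_funM.
  - move=> t; rewrite /halfline /= in_itv /= andbT => t0.
    by rewrite lee_fin; exact: weighted_sum_le.
apply: (le_trans (lee_wpmul2l _ le_int)); first by rewrite lee_fin.
(* The integral contributes 2 T and the prefactor 2/T; 4 times 128^2 is 256^2. *)
rewrite integral_exp_halfline // -EFinM lee_fin /C le_eqVlt; apply/orP; left; apply/eqP.
by field; rewrite gt_eqF.
Unshelve. all: by end_near. Qed.

(** Ensures that the logarithm in [log_ratio] is not taken at 0, where it has a default value. One
    site beyond y suffices: its amplitude is positive for small t > 0 by its leading Taylor term. *)
Lemma outside_prob_gt0 (y T : R) : 0 < T -> (0 < outside_prob V y T)%E.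
Proof.
move=> T0; pose n := Num.bound y.
have yn : y < n.+1%:R.
  have [y0|y0] := ltP y 0; first by rewrite (lt_trans y0) // ltr0n.
  by rewrite (lt_le_trans (archi_boundP y0)) // ler_nat.
have M0 : 0 <= M := le_trans (normr_ge0 _) (VM 0%N).
set K := M + 2; have K0 : 0 < K by rewrite ltr_wpDl.
have f0 : 0 < (n`!)%:R :> R by rewrite ltr0n fact_gt0.
have e0 : 0 < expR (1 : R) by exact: expR_gt0.
(* For t <= d1 the error term of [amplitude_ge] is at most half of t^n/n!; the bound t <= 1/K meets
   its hypothesis. *)
pose d1 := (4 * expR 1 * (n`!)%:R * K ^+ n.+1)^-1.
have Kn : 0 < K ^+ n.+1 by exact: exprn_gt0.
have d10 : 0 < d1 by rewrite invr_gt0 mulr_gt0 // mulr_gt0 // mulr_gt0.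
pose d := Num.min K^-1 d1.
have d0 : 0 < d by rewrite lt_min invr_gt0 K0.
have d20 : 0 < d / 2 by rewrite divr_gt0.
pose c0 := (d / 2) ^+ n / (2 * (n`!)%:R).
have c00 : 0 < c0 by rewrite divr_gt0 ?exprn_gt0 // mulr_gt0.
pose c := c0 ^+ 2 * expR (- (2 * d / T)).
have cpos : 0 < c by rewrite mulr_gt0 ?exprn_gt0 // expR_gt0.
have low t : d / 2 <= t <= d -> c <= weighted n T t.
  move=> /andP[dt td]; have t0 : 0 < t by exact: lt_le_trans dt.
  have tK : t * K <= 1.
    by rewrite -ler_pdivlMr // mul1r (le_trans td) // ge_min lexx.
  have td1 : t <= d1 by rewrite (le_trans td) // ge_min lexx orbT.
  have amp : c0 <= amplitude V n t.
    apply: le_trans (amplitude_ge VM n t0 tK); rewrite -/K.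
    have -> : t ^+ n / (n`!)%:R - 2 * expR 1 * (t * K) ^+ n.+1 =
      t ^+ n * ((n`!)%:R^-1 - 2 * expR 1 * K ^+ n.+1 * t) by rewrite exprMn exprSr; ring.
    have h1 : (d / 2) ^+ n <= t ^+ n by rewrite lerXn2r ?nnegrE ?(ltW d20) ?(ltW t0).
    have h2 : (2 * (n`!)%:R)^-1 <= (n`!)%:R^-1 - 2 * expR 1 * K ^+ n.+1 * t.
      have : 2 * expR 1 * K ^+ n.+1 * t <= 2 * expR 1 * K ^+ n.+1 * d1.
        by rewrite ler_wpM2l // mulr_ge0 ?(ltW Kn) // mulr_ge0 // ltW.
      have -> : 2 * expR 1 * K ^+ n.+1 * d1 = (2 * (n`!)%:R)^-1.
        by rewrite /d1; field; rewrite !gt_eqF.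
      have -> : (n`!)%:R^-1 = 2 * (2 * (n`!)%:R)^-1 :> R by field; rewrite gt_eqF.
      by lra.
    apply: ler_pM h1 h2; first by rewrite exprn_ge0 // ltW.
    by rewrite invr_ge0 mulr_ge0 // ltW.
  rewrite /c /weighted ler_pM ?sqr_ge0 ?expR_ge0 //.
    by rewrite lerXn2r ?nnegrE ?(ltW c00) // (le_trans (ltW c00)).
  rewrite ler_expR lerN2 ler_wpM2r ?invr_ge0 ?(ltW T0) //.
  by rewrite ler_wpM2l.
pose I : set R := `[d / 2, d]%classic.
have int_gt0 : (0 < \int[mu]_(t in halfline) (weighted n T t)%:E)%E.
  apply: (@lt_le_trans _ _ (\int[mu]_(t in I) (cst c%:E t))%E).
    rewrite integral_cst; last exact: measurable_itv.
    rewrite mule_gt0 ?lte_fin //.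
    suff: (0 < mu I)%E by [].
    rewrite /mu /I lebesgue_measure_itv /= lte_fin.
    have dd : d / 2 < d by rewrite ltr_pdivrMr // ltr_pMr // ltr1n.
    by rewrite dd -EFinB lte_fin subr_gt0.
  have IH : I `<=` halfline.
    move=> t; rewrite /I /halfline /= !in_itv /= andbT => /andP[dt _].
    by rewrite (le_trans (ltW d20)).
  have mI : measurable I by exact: measurable_itv.
  apply: (@le_trans _ _ (\int[mu]_(t in I) (weighted n T t)%:E)%E).
    apply: ge0_le_integral => //.
    - by move=> t _; rewrite lee_fin ltW.
    - exact: measurable_funS measurable_halfline IH (measurable_weighted n T).
  apply: ge0_subset_integral => //; first exact: measurable_halfline.
    exact: measurable_weighted.
  by move=> t _; rewrite lee_fin weighted_ge0.
have T20 : 0 < 2 / T by rewrite divr_gt0.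
apply: (@lt_le_trans _ _ ((2 / T)%:E * \int[mu]_(t in halfline) (weighted n T t)%:E)%E).
  by rewrite mule_gt0.
have term_ge0 k : (0 <= (2 / T)%:E * \int[mu]_(t in halfline) (weighted k T t)%:E)%E.
  apply: mule_ge0; first by rewrite lee_fin ltW.
  by apply: integral_ge0 => t _; rewrite lee_fin weighted_ge0.
apply: le_trans (nneseries_lim_ge n.+1 (fun k _ _ => term_ge0 k)).
rewrite big_mkcond big_nat_recr //= yn leeDr //; apply: sume_ge0 => k _.
by case: ifP => // _; exact: term_ge0.
Qed.

End OutsideProbability.

(** * Transport exponents *)

Section Exponents.
Local Open Scope classical_set_scope.
Local Open Scope ring_scope.
Local Open Scope complex_scope.
Variables (R : realType) (V : nat -> R) (M beta : R) (q : nat -> nat).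
Hypothesis VM : forall n, `|V n| <= M.
Hypothesis beta_gt3 : 3 < beta.
Hypothesis q_increasing : forall l m : nat, (l < m)%N -> (q l < q m)%N.
Hypothesis q_gt1 : forall l, (1 < q l)%N.
Hypothesis small_bands : forall l : nat,
  \big[Order.max/0]_(j < q l) band_width V (q l) j < (q l)%:R `^ (- beta).

(** Common to both exponents: D = 1 serves the times with T^a = q l, a larger D serves all large
    times when consecutive periods have bounded ratio. T0 and d do not depend on l. *)
Lemma log_ratio_le (a D : R) : 3 / beta < a -> 1 <= D ->
  exists T0 d : R, [/\ 1 < T0, 0 < d &
    forall (T : R) l, T0 <= T -> T `^ a / D <= (q l)%:R <= T `^ a ->
      (log_ratio V a T <= (- d)%:E)%E].
Proof.
move=> a_gt D1.
have beta0 : 0 < beta by exact: lt_trans beta_gt3.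
have beta1 : 1 < beta by apply: lt_trans beta_gt3; rewrite ltr1n.
have b3 := beta_gt3.
have ab : 3 < a * beta by rewrite -ltr_pdivrMr.
have a0 : 0 < a by apply: le_lt_trans a_gt; rewrite divr_ge0 // ltW.
pose g := a * (beta - 1).
have g2 : 2 < g.
  (* For a <= 1, g = a beta - a > 3 - 1; for a > 1, g > beta - 1 > 2. *)
  rewrite /g; have [a1|a1] := leP a 1; first by lra.
  by nra.
have D0 : 0 < D by exact: lt_le_trans D1.
pose kap := ln D; have kap0 : 0 <= kap by exact: ln_ge0.
have bk0 : 0 <= (beta - 1) * kap by rewrite mulr_ge0 // subr_ge0 ltW.
have l4 : 0 <= ln (4 : R) by rewrite ln_ge0 // ler1n.
have l256 : 0 <= ln (256 : R) by rewrite ln_ge0 // ler1n.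
pose num := 2 * ln (256 : R) + 2 * ((beta - 1) * kap).
have num0 : 0 <= num by rewrite addr_ge0 // mulr_ge0.
(* Threshold for ln T: the middle summand secures 4 q b T <= 1, and the last absorbs the constants
   of the final bound into half of the decay exponent 2 (g - 2). *)
pose lam0 := 1 + (ln (4 : R) + (beta - 1) * kap) + num / (g - 2).
have g20 : 0 < g - 2 by rewrite subr_gt0.
have frac0 : 0 <= num / (g - 2) by rewrite divr_ge0 // ltW.
exists (expR lam0), (g - 2); split => //; first by rewrite expR_gt1 /lam0; lra.
move=> T l T0T /andP[qT Tq].
have T_gt0 : 0 < T by apply: lt_le_trans T0T; exact: expR_gt0.
pose lam := ln T.
have TE : T = expR lam by rewrite lnK // posrE.
have lam_ge : lam0 <= lam by rewrite -ler_expR -TE.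
have lam1 : 1 <= lam by move: lam_ge; rewrite /lam0; lra.
have T1 : 1 <= T by rewrite TE -expR0 ler_expR; lra.
have q0 : 0 < (q l)%:R :> R by rewrite ltr0n ltnW.
have [n qn] : exists n, q l = n.+2.
  by have := q_gt1 l; case: (q l) => [|[|n]] // _; exists n.
pose b : R := (q l)%:R `^ (- beta).
have bw j : (j < n.+2)%N -> band_width V n.+2 j <= b.
  rewrite -qn => jq; apply/ltW; apply: le_lt_trans (small_bands l).
  exact: (@le_bigmax _ _ _ 0 (fun j : 'I_(q l) => band_width V (q l) j) (Ordinal jq)).
have lnq : a * lam - kap <= ln (q l)%:R.
  have -> : a * lam - kap = ln (T `^ a / D).
    by rewrite ln_div ?posrE ?powR_gt0 // ln_powR.
  by rewrite ler_ln ?posrE // divr_gt0 // powR_gt0.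
have qb : (q l)%:R * b <= expR (- g * lam + (beta - 1) * kap).
  rewrite -{1}[(q l)%:R]lnK ?posrE // /b /powR gt_eqF // -expRD ler_expR.
  rewrite (_ : ln _ + _ = - ((beta - 1) * ln (q l)%:R)); last by ring.
  have : (beta - 1) * (a * lam - kap) <= (beta - 1) * ln (q l)%:R.
    by rewrite ler_wpM2l // subr_ge0 ltW.
  by rewrite /g; lra.
have qb0 : 0 <= (q l)%:R * b by rewrite mulr_ge0 ?powR_ge0 // ltW.
have cond : 4 * n.+2%:R * b * T <= 1.
  rewrite -qn -(mulrA 4) -[leRHS]expR0.
  apply: (@le_trans _ _ (expR (ln 4) * expR (- g * lam + (beta - 1) * kap) * T)).
    rewrite lnK ?posrE // ler_wpM2r ?(ltW T_gt0) // ler_wpM2l //.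
  rewrite TE -!expRD ler_expR.
  have : 1 * lam <= (g - 1) * lam by rewrite ler_wpM2r //; lra.
  by move: lam_ge; rewrite /lam0; lra.
have := outside_prob_le VM bw T1 cond _; rewrite -qn => /(_ _ Tq) up.
have lo := outside_prob_gt0 VM (T `^ a) T_gt0.
have pfin : outside_prob V (T `^ a) T \is a fin_num.
  rewrite ge0_fin_numE ?(ltW lo) //; apply: le_lt_trans up _; exact: ltry.
set p := fine (outside_prob V (T `^ a) T).
have pE : outside_prob V (T `^ a) T = p%:E by rewrite /p fineK.
have p0 : 0 < p by rewrite -lte_fin -pE.
have p_le : p <= expR (- (g - 2) * lam).
  have : p <= 256 ^+ 2 * ((q l)%:R * b) ^+ 2 * T ^+ 4 by rewrite -lee_fin -pE.
  move=> /le_trans; apply.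
  apply: (@le_trans _ _ (expR (ln 256) ^+ 2 * expR (- g * lam + (beta - 1) * kap) ^+ 2
     * expR lam ^+ 4)).
    rewrite lnK ?posrE // -TE ler_wpM2r ?exprn_ge0 ?(ltW T_gt0) //.
    by rewrite ler_wpM2l ?sqr_ge0 // lerXn2r ?nnegrE ?expR_ge0.
  rewrite -!expRM_natl -!expRD ler_expR.
  have : num <= (g - 2) * lam.
    rewrite -ler_pdivrMl // mulrC; apply: le_trans lam_ge; rewrite /lam0; lra.
  by rewrite /num; lra.
rewrite /log_ratio -/p lee_fin -/lam ler_pdivrMr; last by lra.
by rewrite -ler_expR lnK ?posrE.
Qed.

Lemma leq_q l : (l <= q l)%N.
Proof. by elim: l => [//|l IH]; apply: leq_ltn_trans IH (q_increasing (ltnSn l)). Qed.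

(** Along the unbounded times (q l)^(1/a), T^a is exactly a period, so the case D = 1 keeps the
    ratio below - d. *)
Lemma limf_einf_log_ratio (a : R) : 3 / beta < a ->
  limf_einf (log_ratio V a) +oo%R != 0%E.
Proof.
move=> a_gt; have [T0 [d [T01 d0 h]]] := log_ratio_le a_gt (lexx 1).
have beta0 : 0 < beta by exact: lt_trans beta_gt3.
have a0 : 0 < a by apply: le_lt_trans a_gt; rewrite divr_ge0 // ltW.
suff : (limf_einf (log_ratio V a) +oo%R <= (- d)%:E)%E.
  by apply: contraTneq => ->; rewrite -ltNge lte_fin oppr_lt0.
rewrite limf_einfE; apply: ge_ereal_sup => _ [A [B [_ BA]] <-].
pose B1 := Num.max B T0.
have B10 : 0 < B1 by rewrite lt_max (lt_trans _ T01) ?orbT.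
pose l := Num.bound (B1 `^ a).
have ql : B1 `^ a < (q l)%:R.
  apply: (lt_le_trans (archi_boundP (powR_ge0 _ _))).
  by rewrite ler_nat leq_q.
pose T := (q l)%:R `^ a^-1 : R.
have TB : B1 < T.
  rewrite -[B1]powRr1 ?(ltW B10) // -(@mulfV _ a) ?gt_eqF // powRrM.
  by rewrite gt0_ltr_powR ?nnegrE ?powR_ge0 ?invr_gt0.
have Ta : T `^ a = (q l)%:R by rewrite /T -powRrM mulVf ?gt_eqF // powRr1.
apply: (@le_trans _ _ (log_ratio V a T)).
  apply: ereal_inf_lbound; exists T => //; apply: BA.
  by rewrite (le_lt_trans _ TB) // le_max lexx.
apply: (h T l); last by rewrite Ta divr1 lexx.
by rewrite (le_trans _ (ltW TB)) // le_max lexx orbT.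
Qed.

(** Every large T satisfies q l <= T^a < q (l + 1) for some l, so the bounded ratio of consecutive
    periods puts q l within a factor D of T^a at all large times. *)
Lemma limf_esup_log_ratio (a D : R) : 3 / beta < a ->
  (forall l, (q l.+1)%:R <= D * (q l)%:R) ->
  limf_esup (log_ratio V a) +oo%R != 0%E.
Proof.
move=> a_gt qD.
have q0 l : 0 < (q l)%:R :> R by rewrite ltr0n ltnW.
have D1 : 1 <= D.
  rewrite -(ler_pM2r (q0 0%N)) mul1r; apply: le_trans (qD 0%N).
  by rewrite ler_nat ltnW // q_increasing.
have D0 : 0 < D by exact: lt_le_trans D1.
have [T0 [d [T01 d0 h]]] := log_ratio_le a_gt D1.
have beta0 : 0 < beta by exact: lt_trans beta_gt3.
have a0 : 0 < a by apply: le_lt_trans a_gt; rewrite divr_ge0 // ltW.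
suff : (limf_esup (log_ratio V a) +oo%R <= (- d)%:E)%E.
  by apply: contraTneq => ->; rewrite -ltNge lte_fin oppr_lt0.
rewrite limf_esupE.
(* The second entry ensures q 0 <= T^a, so that the least index whose period exceeds T^a is a
   successor. *)
pose T1 := Num.max T0 ((q 0%N)%:R `^ a^-1).
apply: (@le_trans _ _ (ereal_sup (log_ratio V a @` [set T | T1 < T]))).
  apply: ereal_inf_lbound; exists [set T | T1 < T] => //.
  by exists T1; split => //; exact: num_real.
apply: ge_ereal_sup => _ [T /= T1T <-].
have TT0 : T0 < T by apply: le_lt_trans T1T; rewrite /T1 le_max lexx.
have T_gt0 : 0 < T by rewrite (lt_trans _ TT0) // (lt_trans _ T01).
have qT : (q 0%N)%:R <= T `^ a.
  have q0T : (q 0%N)%:R `^ a^-1 <= T.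
    by apply: ltW; apply: le_lt_trans T1T; rewrite /T1 le_max lexx orbT.
  have q0E : (q 0%N)%:R = ((q 0%N)%:R `^ a^-1) `^ a :> R.
    by rewrite -powRrM mulVf ?gt_eqF // powRr1 // ltW.
  by rewrite q0E; apply: ge0_ler_powR; rewrite ?nnegrE ?powR_ge0 ?(ltW a0) ?(ltW T_gt0).
have ex : exists l, T `^ a < (q l)%:R.
  exists (Num.bound (T `^ a)); apply: (lt_le_trans (archi_boundP (powR_ge0 _ _))).
  by rewrite ler_nat leq_q.
have := ex_minnP ex; case=> -[|l] Tl min; first by move: Tl; rewrite ltNge qT.
have lT : (q l)%:R <= T `^ a.
  by rewrite leNgt; apply/negP => /min; rewrite ltnn.
apply: (h T l (ltW TT0)); rewrite lT andbT ler_pdivrMr // mulrC.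
exact: le_trans (ltW Tl) (qD l).
Qed.

Lemma exponentially_growing_ratio :
  exponentially_growing (fun l => (q l)%:R : R) ->
  exists D : R, forall l, (q l.+1)%:R <= D * (q l)%:R.
Proof.
move=> [sup_fin _]; have q0 l : 0 < (q l)%:R :> R by rewrite ltr0n ltnW.
move: sup_fin; set S := [set _ | _ in _] => sup_fin.
have Sl l : (((q l.+1)%:R / (q l)%:R)%:E <= ereal_sup S)%E.
  by apply: ereal_sup_ubound; exists l.
have Sfin : ereal_sup S \is a fin_num.
  by rewrite fin_numE -ltey sup_fin andbT -ltNye (lt_le_trans _ (Sl 0%N)) // ltNyr.
exists (fine (ereal_sup S)) => l.
by rewrite -ler_pdivrMr // -lee_fin fineK.
Qed.

Lemma alpha_l_minus_le : (alpha_l_minus V <= (3 / beta)%:E)%E.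
Proof.
have beta0 : 0 < beta by exact: lt_trans beta_gt3.
rewrite /alpha_l_minus ge_max lee_fin divr_ge0 ?(ltW beta0) //=.
apply: ge_ereal_sup => _ [a [_ a_lim] <-]; rewrite lee_fin leNgt.
by apply/negP => /limf_einf_log_ratio; rewrite a_lim eqxx.
Qed.

Lemma alpha_l_plus_le : exponentially_growing (fun l => (q l)%:R : R) ->
  (alpha_l_plus V <= (3 / beta)%:E)%E.
Proof.
move=> /exponentially_growing_ratio[D qD].
have beta0 : 0 < beta by exact: lt_trans beta_gt3.
rewrite /alpha_l_plus ge_max lee_fin divr_ge0 ?(ltW beta0) //=.
apply: ge_ereal_sup => _ [a [_ a_lim] <-]; rewrite lee_fin leNgt.
by apply/negP => a_gt; move: (limf_esup_log_ratio a_gt qD); rewrite a_lim eqxx.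
Qed.

End Exponents.

Unset Implicit Arguments.

Theorem corollary1p3 (R : realType) (V : nat -> R)
  (V_bounded : exists M : R, forall n : nat, `|V n| <= M)
  (beta : R) (beta_gt3 : 3 < beta)
  (q : nat -> nat)
  (q_increasing : forall l m : nat, (l < m)%N -> (q l < q m)%N)
  (q_gt1 : forall l : nat, (1 < q l)%N)
  (small_bands : forall l : nat,
     \big[Order.max/0]_(j < q l) band_width V (q l) j < (q l)%:R `^ (- beta)) :
  (alpha_l_minus V <= (3 / beta)%:E)%E /\
  (exponentially_growing (fun l : nat => (q l)%:R : R) ->
     (alpha_l_plus V <= (3 / beta)%:E)%E).
Proof.
have [M VM] := V_bounded; split.
  exact: (alpha_l_minus_le VM beta_gt3 q_increasing q_gt1 small_bands).
exact: (alpha_l_plus_le VM beta_gt3 q_increasing q_gt1 small_bands).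
Qed.
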